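(* Let $\mathcal{R}$ and $\mathcal{B}$ be independent homogeneous Poisson processes on $\mathbb{R}$ with intensities $\lambda_{\mathcal{R}},\lambda_{\mathcal{B}}\in(0,\infty)$, and let $\nu$ and $\mu$ be probability laws on the strictly positive integers with finite means such that $\lambda_{\mathcal{R}}\,\mathbb{E}[X]=\lambda_{\mathcal{B}}\,\mathbb{E}[Y]$, where $X\sim\nu$ and $Y\sim\mu$. Then, almost surely, the graph given by the two-color stable multi-matching of $\mathcal{R}$ and $\mathcal{B}$ with degree laws $\nu$ and $\mu$ has at most one infinite connected component.
   Context: The points of $\mathcal{R}$ (its support $[\mathcal{R}]$) are called red points and the points of $\mathcal{B}$ (its support $[\mathcal{B}]$) are called blue points. Conditionally on $\mathcal{R}$ and $\mathcal{B}$, each red point is independently equipped with a random number of stubs (half-edges) with law $\nu$, and each blue point independently with a random number of stubs with law $\mu$; the two marked processes are independent. A two-color multi-matching scheme is a point process $\mathcal{M}$ on the space of unordered pairs of points of $\mathbb{R}$ such that almost surely every pair in $[\mathcal{M}]$ consists of one red and one blue point, and in the bipartite graph with vertex set $[\mathcal{R}]\cup[\mathcal{B}]$ and edge set $[\mathcal{M}]$ every vertex has degree equal to its number of stubs. Only simple (no multiple edges) and translation-invariant (law of $\mathcal{M}$ invariant under all translations of $\mathbb{R}$) schemes are considered. A two-color multi-matching is stable if almost surely, for any red point $x$ and any blue point $y$, either $x$ and $y$ are linked by an edge, or at least one of $x$ and $y$ has no incident edge longer than $|x-y|$. It is known that, when $\nu$ and $\mu$ have finite means and $\lambda_{\mathcal{R}}\mathbb{E}[X]=\lambda_{\mathcal{B}}\mathbb{E}[Y]$,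 a stable two-color multi-matching exists and is almost surely unique. It is obtained by the following procedure: repeatedly, call two points compatible if they have different colors, each still has at least one stub left, and no edge has been created between them; create simultaneously an edge between every pair of mutually closest compatible points and remove one stub from each of these points; iterate indefinitely. This is ''the two-color stable multi-matching''. *)

(* Defs.v *)
From mathcomp Require Import finmap.
From Stdlib Require Export Relation_Operators.
From mathcomp Require Export all_boot all_order all_algebra.
From mathcomp Require Export all_classical all_reals all_analysis measurable_realfun.
Set Implicit Arguments.
Unset Strict Implicit.
Unset Printing Implicit Defensive.
Import Order.TTheory GRing.Theory Num.Theory.
Import numFieldNormedType.Exports.
Local Open Scope classical_set_scope.
Local Open Scope ring_scope.

(* (x, k) is a point x of the line equipped with k stubs. *)
Notation marked_point R := (R * nat)%type (only parsing).

Section independence.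
Context (d : measure_display) (T : measurableType d) (R : realType).
Variable P : probability T R.

Definition sigma_rv (d' : measure_display) (T' : measurableType d')
    (f : T -> T') : set_system T :=
  preimage_set_system setT f measurable.

Definition sigma_rvs (I : Type) (D : set I) (d' : measure_display)
    (T' : measurableType d') (f : I -> T -> T') : set_system T :=
  <<s \bigcup_(i in D) sigma_rv (f i) >>.

Definition mutually_independent (I : eqType) (F : I -> set_system T) : Prop :=
  forall (J : seq I) (E : I -> set T), uniq J ->
    (forall i, i \in J -> F i (E i)) ->
    P (\bigcap_(i in [set` J]) E i) = (\prod_(i <- J) P (E i))%E.

Definition independent (F G : set_system T) : Prop :=
  forall A B, F A -> G B -> P (A `&` B) = (P A * P B)%E.

End independence.

Section point_processes.
Context (d : measure_display) (T : measurableType d) (R : realType).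
Variable P : probability T R.

(* A simple point process is identified with its random support. *)
Definition count (S : choiceType) (Phi : T -> set S) (A : set S) (w : T) :
    \bar R :=
  counting (Phi w `&` A).

Definition point_process (d' : measure_display) (S : measurableType d')
    (Phi : T -> set S) : Prop :=
  forall A : set S, measurable A -> measurable_fun setT (count Phi A).

(* The weights are spelled out because [poisson_pmf] is constantly 1 at
   rate 0, while A is allowed to be Lebesgue-null here. *)
Definition homogeneous_poisson (lambda : R) (Phi : T -> set R) : Prop :=
  [/\ point_process Phi,
      (forall (A : set R) (k : nat), measurable A ->
         (lebesgue_measure A < +oo)%E ->
         let rate := lambda * fine (lebesgue_measure A) in
         P [set w | count Phi A w = k%:R%:E] =
           (rate ^+ k / k`!%:R * expR (- rate))%:E) &
      (forall A : nat -> set R, (forall i, measurable (A i)) ->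
         trivIset setT A ->
         mutually_independent P (fun i => sigma_rv (count Phi (A i))))].

(* Independent marking: for some measurable enumeration X_0, X_1, ... of the
   points, the mark of X_n is D_n, where the D_n have law nu and X, D_0, D_1,
   ... are mutually independent. The index None stands for the sequence X. *)
Definition independently_marked (nu : probability nat R)
    (xi : T -> set (marked_point R)) : Prop :=
  exists (X : nat -> {RV P >-> R}) (D : nat -> {RV P >-> nat}),
    [/\ {ae P, forall w, injective (fun n => X n w) /\
                         xi w = range (fun n => (X n w, D n w))},
        (forall n (A : set nat), distribution P (D n) A = nu A) &
        mutually_independent P (fun o : option nat =>
          if o is Some n then sigma_rv (D n)
          else sigma_rvs setT (fun n => X n : T -> R))].

Definition marked_poisson (lambda : R) (nu : probability nat R)
    (xi : T -> set (marked_point R)) : Prop :=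
  [/\ point_process xi,
      homogeneous_poisson lambda (fun w => fst @` xi w) &
      independently_marked nu xi].

Definition sigma_process (d' : measure_display) (S : measurableType d')
    (Phi : T -> set S) : set_system T :=
  sigma_rvs measurable (count Phi).

End point_processes.

Section matching.
Context (R : realType).
Variables red blue : set (marked_point R).

(* Edge sets of bipartite graphs: [E u v] links the red u to the blue v. *)
Implicit Types (E : marked_point R -> marked_point R -> Prop).
Implicit Types (u v : marked_point R).

Definition dist u v : R := `|u.1 - v.1|.

Definition red_stub_left E u : Prop :=
  (counting [set v | E u v] < u.2%:R%:E :> \bar R)%E.

Definition blue_stub_left E v : Prop :=
  (counting [set u | E u v] < v.2%:R%:E :> \bar R)%E.

Definition compatible E u v : Prop :=
  [/\ red u, blue v, red_stub_left E u, blue_stub_left E v & ~ E u v].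

(* "Closest" is strict; this matters only in the presence of ties between
   distances, which a.s. do not occur. *)
Definition mutually_closest E u v : Prop :=
  [/\ compatible E u v,
      (forall v', compatible E u v' -> v' <> v -> dist u v < dist u v') &
      (forall u', compatible E u' v -> u' <> u -> dist u v < dist u' v)].

Definition matching_step E : marked_point R -> marked_point R -> Prop :=
  fun u v => E u v \/ mutually_closest E u v.

Definition matching_stage (n : nat) :
    marked_point R -> marked_point R -> Prop :=
  iter n matching_step (fun _ _ => False).

Definition stable_multi_matching u v : Prop := exists n, matching_stage n u v.

Definition stable E : Prop := forall u v, red u -> blue v ->
  [\/ E u v,
      (forall v', E u v' -> dist u v' <= dist u v) |
      (forall u', E u' v -> dist u' v <= dist u v)].

Lemma matching_stage_le m n u v :
  (m <= n)%N -> matching_stage m u v -> matching_stage n u v.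
Proof.
move=> /subnK <-; elim: (n - m)%N => // k IHk /IHk; exact: or_introl.
Qed.

Lemma matching_stage_compatible n u v : matching_stage n u v ->
  exists m, mutually_closest (matching_stage m) u v.
Proof. by elim: n => //= n IHn [/IHn|]; last by exists n. Qed.

Lemma counting_le (S : choiceType) (A B : set S) :
  A `<=` B -> (counting A <= counting B :> \bar R)%E.
Proof.
move=> AB; rewrite /counting; case: asboolP => fA; case: asboolP => fB //.
- rewrite lee_fin ler_nat; apply: fsubset_leq_card.
  by rewrite -fset_set_sub.
- by rewrite leey.
- by case: fA; exact: sub_finite_set fB.
Qed.

Lemma stub_left_le m n u v : (m <= n)%N ->
  (red_stub_left (matching_stage n) u -> red_stub_left (matching_stage m) u) /\
  (blue_stub_left (matching_stage n) v -> blue_stub_left (matching_stage m) v).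
Proof.
by move=> mn; split; apply: le_lt_trans; apply: counting_le => w /=;
  exact: matching_stage_le.
Qed.

Lemma stable_multi_matching_stable : stable stable_multi_matching.
Proof.
move=> u v ru bv; have [|nE] := pselect (stable_multi_matching u v).
  by constructor 1.
have [|/existsNP[v' /not_implyP[[n Euv'] /negP]]] :=
  pselect (forall v', stable_multi_matching u v' -> dist u v' <= dist u v).
  by constructor 2.
rewrite -ltNge => ltv; constructor 3 => u' [n' Eu'v].
rewrite leNgt; apply/negP => ltu.
have [m [[_ bv' su sv' nEm] cl1 cl2]] := matching_stage_compatible Euv'.
have [m' [[ru' _ su' sv nEm'] cl1' cl2']] := matching_stage_compatible Eu'v.
have nEk k : ~ matching_stage k u v by move=> Ek; apply: nE; exists k.
have [mm'|/ltnW m'm] := leqP m m'.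
- have cuv : compatible (matching_stage m) u v.
    by split=> //; apply: (stub_left_le u v mm').2.
  have vv' : v <> v' by move=> vv'; rewrite -vv' ltxx in ltv.
  by have := lt_trans (cl1 _ cuv vv') ltv; rewrite ltxx.
- have cuv : compatible (matching_stage m') u v.
    by split=> //; apply: (stub_left_le u v m'm).1.
  have uu' : u <> u' by move=> uu'; rewrite -uu' ltxx in ltu.
  by have := lt_trans (cl2' _ cuv uu') ltu; rewrite ltxx.
Qed.

End matching.

Section components.
Context (R : realType).
Variables red blue : set (marked_point R).
Variable E : marked_point R -> marked_point R -> Prop.

(* Red vertices are tagged inl, blue vertices inr. *)
Definition vertex : Type := (marked_point R + marked_point R)%type.

Definition vertices : set vertex := (inl @` red) `|` (inr @` blue).

Definition adjacent (a b : vertex) : Prop :=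
  match a, b with
  | inl u, inr v => E u v
  | inr v, inl u => E u v
  | _, _ => False
  end.

Definition component (a : vertex) : set vertex :=
  [set b | clos_refl_trans vertex adjacent a b].

Definition infinite_components : set (set vertex) :=
  [set C | (component @` vertices) C /\ infinite_set C].

End components.

(* Main.v *)
From mathcomp Require Import ring lra finmap.
From Stdlib Require Import Operators_Properties.
Require Import Defs.
Set Implicit Arguments.
Unset Strict Implicit.
Unset Printing Implicit Defensive.
Import Order.TTheory GRing.Theory Num.Theory.
Import numFieldNormedType.Exports.
Local Open Scope classical_set_scope.
Local Open Scope ring_scope.

(** Why the theorem holds. In a stable matching two crossing edges belong to the
   same component ([crossing_conn]). Hence an infinite component cannot have a
   vertex under an edge of another one, and two infinite components occupy
   disjoint intervals of the line ([unbounded_components_ordered]). The left one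
   is then bounded above, so it has a rightmost vertex, and it is unbounded
   below because the configuration is locally finite; such a vertex is called a
   right end ([right_end]). All the right ends of a configuration sit at the same
   position, since two components unbounded to the left cannot occupy disjoint
   intervals ([right_end_unique]).

   It remains to see that almost surely there is no right end. The law of the
   pair of marked processes is invariant under translations, so the events that
   there is a right end in [t + n, t + n + 1), n = 0, 1, 2, ..., have the same
   probability; as they are disjoint, they are null ([ae_no_right_end_in]).

   Two facts support the use of translation invariance.

   The first is the invariance itself ([config_law_translate]). The events that
   a region contains no red point and another one no blue point form a
   pi-system, and it suffices to compare their probabilities. By independence
   this reduces to one colour. For a region made of finitely many cells of
   finite length with a set of forbidden marks in each of them, the probability
   that it contains no point is computed by conditioning on the numbers of
   points in the cells: the marks being independent of the points, it depends
   only on the lengths of the cells ([void_probability_eq]).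

   The second is that the existence of a right end in a given interval is an
   event of the sigma-algebra generated by these void events
   ([observable_right_end_in]). In a regular configuration each point is alone
   in some box with rational endpoints, so that quantifiers over points become
   countable, and the position of the point alone in a given box is a measurable
   function of the configuration. *)

(** * Geometry of stable bipartite graphs on the line *)

(** A graph with coloured vertices placed on the line: edges join vertices of
   different colours, and two vertices of the same colour and position are
   equal. [adj_stable] is the stability condition, for the distance between
   positions. *)
Section stable_geometric_graphs.
Context (R : realType) (V : choiceType).
Variables (pos : V -> R) (col : V -> bool) (vs : set V) (adj : V -> V -> Prop).
Hypothesis adjC : forall a b, adj a b -> adj b a.
Hypothesis adjP : forall a b, adj a b -> [/\ vs a, vs b & col a != col b].
Hypothesis pos_inj : forall a b,
  vs a -> vs b -> col a = col b -> pos a = pos b -> a = b.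
Hypothesis adj_stable : forall a b, vs a -> vs b -> col a != col b ->
  [\/ adj a b,
      (forall c, adj a c -> `|pos a - pos c| <= `|pos a - pos b|) |
      (forall c, adj b c -> `|pos b - pos c| <= `|pos a - pos b|)].

Local Notation conn := (clos_refl_trans V adj).

Lemma conn_sym a b : conn a b -> conn b a.
Proof.
elim=> [x y /adjC|x|x y z _ yx _ zy]; [exact: rt_step|exact: rt_refl|].
exact: rt_trans zy yx.
Qed.

Lemma conn_ind_step (a : V) (Q : V -> Prop) : Q a ->
  (forall x y, conn a x -> Q x -> adj x y -> Q y) -> forall b, conn a b -> Q b.
Proof.
move=> Qa QS b /(clos_rt_rtn1 V adj); elim=> // y z yz /(clos_rtn1_rt V adj).
by move=> ay Qy; exact: QS ay Qy yz.
Qed.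

(** Non-isolated vertices of different components are never superposed: having
   different colours and being unlinked, they would violate stability, each of
   them having an edge of positive length. *)
Lemma same_pos_conn a a' b b' :
  adj a a' -> adj b b' -> pos a = pos b -> conn a b.
Proof.
move=> aa' bb' eab; have [va va' cnaa'] := adjP aa'.
have [vb vb' cnbb'] := adjP bb'.
have [cab|cab] := eqVneq (col a) (col b).
  by rewrite (pos_inj va vb cab eab); exact: rt_refl.
have [|h|h] := adj_stable va vb cab; first exact: rt_step.
- have := h _ aa'; rewrite eab subrr normr0 normr_le0 subr_eq0 => /eqP ba'.
  suff -> : b = a' by exact: rt_step.
  apply: pos_inj => //; move: cab cnaa'.
  by case: (col a); case: (col b); case: (col a').
- have := h _ bb'; rewrite eab subrr normr0 normr_le0 subr_eq0 => /eqP eb'.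
  suff -> : a = b' by exact/rt_step/adjC.
  apply: pos_inj => //; last by rewrite eab.
  by move: cab cnbb'; case: (col a); case: (col b); case: (col b').
Qed.

(** Two crossing edges lie in the same component. If the two middle vertices
   have different colours, stability links them. Otherwise the two left ones
   have different colours, and so do the two right ones; were both pairs
   unlinked, stability would give |bd| <= |ab| and |ac| <= |cd|, which is
   impossible since |ab| < |ac| and |cd| < |bd|. *)
Lemma crossing_conn a b c d : adj a c -> adj b d ->
  pos a < pos b -> pos b < pos c -> pos c < pos d -> conn a b.
Proof.
move=> ac bd ab bc cd; have [va vc cac] := adjP ac; have [vb vd cbd] := adjP bd.
have ac' := lt_trans ab bc; have bd' := lt_trans bc cd.
have nE x y : pos x < pos y -> `|pos x - pos y| = pos y - pos x.
  by move=> xy; rewrite distrC ger0_norm// subr_ge0 ltW.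
have [cbc|cbc] := eqVneq (col b) (col c).
- have cab : col a != col b by rewrite cbc.
  have ccd : col c != col d by rewrite -cbc.
  have [h|h|h] := adj_stable va vb cab; first exact: rt_step.
    by have := h _ ac; rewrite !nE// lerD2r leNgt bc.
  have {}h := h _ bd; rewrite !nE// in h.
  have [h'|h'|h'] := adj_stable vc vd ccd.
  + apply: rt_trans (rt_step _ _ _ _ ac) _.
    by apply: rt_trans (rt_step _ _ _ _ h') _; exact/rt_step/adjC.
  + by have := h' _ (adjC ac); rewrite distrC !nE//; lra.
  + by have := h' _ (adjC bd); rewrite distrC !nE//; lra.
- have [h|h|h] := adj_stable vb vc cbc.
  + by apply: rt_trans (rt_step _ _ _ _ ac) _; exact/rt_step/adjC.
  + by have := h _ bd; rewrite !nE// lerD2r leNgt cd.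
  + by have := h _ (adjC ac); rewrite distrC !nE//; lra.
Qed.

(** A component with a vertex under an edge of another component stays under
   that edge. *)
Lemma under_edge_bounded a c x x' : adj a c -> adj x x' ->
  pos a < pos x < pos c -> ~ conn a x ->
  forall z, conn x z -> pos a < pos z < pos c.
Proof.
move=> ac xx' axc nax; apply: conn_ind_step => // z z' xz /andP[az zc] zz'.
have xz' : conn x z' by exact: rt_trans xz (rt_step _ _ _ _ zz').
have naz' : ~ conn a z' by move=> az'; apply: nax;
  exact: rt_trans az' (conn_sym xz').
have naz : ~ conn a z by move=> ?; apply: nax; exact: rt_trans (conn_sym xz).
apply/andP; split.
- case: ltgtP => // [z'a|az'].
  + case: naz'; apply: conn_sym; exact: (crossing_conn (adjC zz') ac).
  + by case: naz'; exact: (same_pos_conn ac (adjC zz')).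
- case: ltgtP => // [cz'|z'c].
  + by case: naz; exact: (crossing_conn ac zz').
  + case: naz'; apply: (rt_trans _ _ _ c); first exact: rt_step.
    by exact: (same_pos_conn (adjC ac) (adjC zz')).
Qed.

(** The component of [x] is an unbounded set of positions. *)
Definition unbounded x := forall N : R, exists2 y, conn x y & N < `|pos y|.

Lemma conn_unbounded x y : conn x y -> unbounded x -> unbounded y.
Proof.
move=> xy ux N; have [z xz Nz] := ux N; exists z => //.
exact: rt_trans (conn_sym xy) xz.
Qed.

Lemma unbounded_adj x : unbounded x -> exists x', adj x x'.
Proof.
move=> /(_ `|pos x|)[y /(clos_rt_rt1n V adj)]; case; first by rewrite ltxx.
by move=> z w xz _ _; exists z.
Qed.

Lemma unbounded_not_between x lo hi : unbounded x ->
  ~ forall z, conn x z -> lo < pos z < hi.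
Proof.
move=> ux h; have [z xz] := ux (Num.max `|lo| `|hi|).
have /andP[lz zh] := h _ xz; rewrite gt_max => /andP[].
by have [|] := ger0P (pos z); have [|] := ger0P lo; have [|] := ger0P hi; lra.
Qed.

(** A component that goes from the left to the right of [x] does so by an edge
   over [x], or through a vertex at the position of [x]. *)
Lemma between_conn x y z : unbounded x -> conn y z ->
  pos y < pos x < pos z -> conn x y.
Proof.
move=> ux yz /andP[yx xz]; apply: contrapT => nxy.
have [x' xx'] := unbounded_adj ux.
suff : pos z < pos x by rewrite ltNge (ltW xz).
move: z yz {xz}; apply: conn_ind_step => // z z' yz zx zz'.
have nz : ~ conn z x by move=> zx'; apply: nxy; apply: conn_sym;
  exact: rt_trans zx'.
case: ltgtP => // [xz'|z'x].
- case: (@unbounded_not_between x (pos z) (pos z') ux).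
  by apply: under_edge_bounded xx' _ _ => //; rewrite zx.
- case: nz; apply: rt_trans (rt_step _ _ _ _ zz') _.
  exact: same_pos_conn (adjC zz') xx' z'x.
Qed.

(** Distinct unbounded components occupy disjoint intervals. *)
Lemma unbounded_components_ordered a b : unbounded a -> unbounded b ->
  ~ conn a b -> pos a < pos b ->
  forall a' b', conn a a' -> conn b b' -> pos a' < pos b'.
Proof.
move=> ua ub nab ab.
have H x y : conn a x -> conn b y -> pos x != pos y.
  move=> ax bx; apply/eqP => exy.
  have [x' xx'] := unbounded_adj (conn_unbounded ax ua).
  have [y' yy'] := unbounded_adj (conn_unbounded bx ub).
  apply: nab; apply: rt_trans ax _; apply: rt_trans (conn_sym bx).
  exact: same_pos_conn xx' yy' exy.
have K a' : conn a a' -> pos a' < pos b.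
  move=> aa'; case: ltgtP (H _ _ aa' (rt_refl _ _ b)) => // ba' _.
  case: nab; apply: conn_sym; apply: between_conn ub aa' _; exact/andP.
move=> a' b' aa' bb'; case: ltgtP (H _ _ aa' bb') => // ba' _.
case: nab; apply: (rt_trans _ _ _ a') => //; apply: (rt_trans _ _ _ b');
  last exact: conn_sym.
apply: between_conn (conn_unbounded aa' ua) (conn_sym bb') _.
by rewrite ba' K.
Qed.

(** A rightmost vertex of a component that is unbounded to the left. *)
Definition right_end a :=
  [/\ vs a, (forall b, conn a b -> pos b <= pos a) &
      (forall N : R, exists2 b, conn a b & pos b < N)].

Lemma right_end_unbounded a : right_end a -> unbounded a.
Proof.
move=> [_ _ h] N; have [b ab bN] := h (- `|N|); exists b => //.
move: bN; by have [|] := ger0P N; have [|] := ger0P (pos b); lra.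
Qed.

Lemma right_end_unique a b : right_end a -> right_end b -> pos a = pos b.
Proof.
move=> ra rb; wlog : a b ra rb / pos a < pos b.
  by move=> H; case: (ltgtP (pos a) (pos b)) => // h; [|symmetry]; exact: H.
move=> ab; have [conn_ab|nab] := pselect (conn a b).
  by case: ra => _ /(_ _ conn_ab); rewrite leNgt ab.
have [_ _ /(_ (pos a))[c bc ca]] := rb.
have := unbounded_components_ordered (right_end_unbounded ra)
  (right_end_unbounded rb) nab ab (rt_refl _ _ a) bc.
by rewrite ltNge (ltW ca).
Qed.

Hypothesis locally_finite : forall N : R, finite_set [set a | vs a /\ `|pos a| <= N].

Lemma conn_vs a b : vs a -> conn a b -> vs b.
Proof. by move=> va; apply: conn_ind_step => // x y _ _ /adjP[]. Qed.

Lemma infinite_unbounded a : vs a -> infinite_set [set b | conn a b] -> unbounded a.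
Proof.
move=> va infa N; apply: contrapT => h; apply: infa.
apply: sub_finite_set (locally_finite N) => b /= ab; split; first exact: conn_vs ab.
by rewrite leNgt; apply/negP => Nb; apply: h; exists b.
Qed.

Lemma finite_set_argmax (A : set V) a : finite_set A -> A a ->
  exists2 m, A m & forall b, A b -> pos b <= pos m.
Proof.
move=> fA Aa; have aA : a \in fset_set A by rewrite in_fset_set// inE.
have [m /= _ hm] := @arg_maxP _ _ _ [` aA]%fset xpredT (fun x => pos (val x)) isT.
exists (val m); first by have := valP m; rewrite in_fset_set// inE.
move=> b Ab; have bA : b \in fset_set A by rewrite in_fset_set// inE.
exact: (hm [` bA]%fset isT).
Qed.

(** The left one of two unbounded components is bounded above, so it has a
   rightmost vertex and extends indefinitely to the left. *)
Lemma two_components_right_end a b : vs a -> vs b ->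
  unbounded a -> unbounded b -> ~ conn a b -> exists m, right_end m.
Proof.
move=> va vb ua ub nab; wlog ab : a b va vb ua ub nab / pos a < pos b.
  move=> H; case: (ltgtP (pos a) (pos b)) => [|ba|eab]; first exact: H.
    by apply: (H b a) => // /conn_sym.
  have [a' aa'] := unbounded_adj ua; have [b' bb'] := unbounded_adj ub.
  by case: nab; exact: same_pos_conn aa' bb' eab.
have le_ab c : conn a c -> pos c < pos b.
  by move=> ac; apply: (unbounded_components_ordered ua ub nab ab) ac (rt_refl _ _ b).
pose A := [set c | conn a c /\ pos a <= pos c].
have fA : finite_set A.
  apply: sub_finite_set (locally_finite (`|pos a| + `|pos b|)) => c [ac lac].
  split; first exact: conn_vs ac.
  have := le_ab _ ac; have [|] := ger0P (pos a); have [|] := ger0P (pos b);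
    by have [|] := ger0P (pos c); lra.
have [m [am lam] mmax] := finite_set_argmax fA (conj (rt_refl _ _ a) (lexx _)).
have mP c : conn a c -> pos c <= pos m.
  move=> ac; have [ca|ac'] := ltP (pos c) (pos a); last by apply: mmax; split.
  exact: le_trans (ltW ca) lam.
exists m; split; first exact: conn_vs am.
  by move=> c mc; apply: mP; exact: rt_trans mc.
move=> N; apply: contrapT => nN.
have [c ac] := ua (`|pos b| + `|N|); apply/negP; rewrite -leNgt.
have Nc : N <= pos c.
  rewrite leNgt; apply/negP => cN; apply: nN; exists c => //.
  exact: rt_trans (conn_sym am) ac.
have := le_ab _ ac; have [|] := ger0P N; have [|] := ger0P (pos b);
  by have [|] := ger0P (pos c); lra.
Qed.

End stable_geometric_graphs.

(** * Counting measure *)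

Lemma counting_ltP (R : realType) (S : choiceType) (A : set S) (k : nat) :
  (counting A < k%:R%:E :> \bar R)%E <->
  ~ exists s : seq S, [/\ uniq s, size s = k & forall x, x \in s -> A x].
Proof.
rewrite /counting; case: asboolP => fA; split.
- rewrite lte_fin ltr_nat => Ak [s [us sk sA]]; move: Ak;
    rewrite ltnNge => /negP; apply.
  rewrite -sk; apply: uniq_leq_size => // x /sA Ax.
  by rewrite in_fset_set// inE.
- move=> h; rewrite lte_fin ltr_nat ltnNge; apply/negP => kA; apply: h.
  exists (take k (fset_set A)); split.
  + exact/take_uniq/fset_uniq.
  + by rewrite size_takel.
  + by move=> x /mem_take; rewrite in_fset_set// inE.
- by rewrite ltNge leey.
- have [B BA kB] := infinite_set_fset k fA.
  case; exists (take k B); split.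
  + exact/take_uniq/fset_uniq.
  + by rewrite size_takel.
  + by move=> x /mem_take xB; exact: BA.
Qed.

Lemma counting_seq (R : realType) (S : choiceType) (s : seq S) : uniq s ->
  counting [set` s] = (size s)%:R%:E :> \bar R.
Proof.
move=> us; rewrite /counting asboolT; last exact: finite_seq.
congr (_%:R%:E); rewrite -(size_map id) map_id.
by apply/perm_size/uniq_perm => // x; rewrite in_fset_set ?mem_setE//;
  exact: finite_seq.
Qed.

Lemma void_eventE (d : measure_display) (T : measurableType d) (R : realType)
  (d' : measure_display) (S : measurableType d') (Phi : T -> set S) (U : set S) :
  [set w | Phi w `&` U = set0] = count R Phi U @^-1` [set 0%E].
Proof.
apply/seteqP; split=> w /=; rewrite /count; first by move=> ->; rewrite measure0.
rewrite /counting; case: asboolP => // fA [] /eqP.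
by rewrite pnatr_eq0 cardfs_eq0 => /eqP/fset_set_set0; exact.
Qed.

(** * The stable multi-matching as a stable graph, and its translates *)

Section translation.
Context (R : realType).
Implicit Types (r b : set (marked_point R)) (s : R).

(** The configuration [r] translated by [s]: [r] is read at [u.1 - s]. *)
Definition translate s r : set (marked_point R) := [set u | r (u.1 - s, u.2)].

Let tau s (u : marked_point R) : marked_point R := (u.1 - s, u.2).

Let tauK s : cancel (tau s) (tau (- s)).
Proof. by case=> x k; rewrite /tau /= opprK subrK. Qed.

Let tauNK s : cancel (tau (- s)) (tau s).
Proof. by case=> x k; rewrite /tau /= opprK addrK. Qed.

Let dist_tau s u v : dist (tau s u) (tau s v) = dist u v.
Proof. by rewrite /dist /tau /= opprB addrA subrK. Qed.

Let counting_tau s (A : set (marked_point R)) (k : nat) :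
  (counting (tau s @^-1` A) < k%:R%:E :> \bar R)%E <->
  (counting A < k%:R%:E :> \bar R)%E.
Proof.
rewrite !counting_ltP; split=> h [l [ul lk lA]]; apply: h.
- exists (map (tau (- s)) l); split.
  + by rewrite map_inj_uniq//; exact: can_inj (tauNK s).
  + by rewrite size_map.
  + by move=> x /mapP[y yl ->]; rewrite /= tauNK; exact: lA.
- exists (map (tau s) l); split.
  + by rewrite map_inj_uniq//; exact: can_inj (tauK s).
  + by rewrite size_map.
  + by move=> x /mapP[y yl ->]; exact: lA.
Qed.

Lemma matching_stage_translate s r b n u v :
  matching_stage (translate s r) (translate s b) n u v <->
  matching_stage r b n (tau s u) (tau s v).
Proof.
elim: n => [//|n IHn] in u v *;
  rewrite /matching_stage !iterS -!/(matching_stage _ _ _).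
set E' := matching_stage (translate s r) (translate s b) n in IHn *.
set E := matching_stage r b n in IHn *.
have compE u' v' : compatible (translate s r) (translate s b) E' u' v' <->
    compatible r b E (tau s u') (tau s v').
  have rE : red_stub_left E' u' <-> red_stub_left E (tau s u').
    rewrite /red_stub_left;
      have -> : [set v | E' u' v] = tau s @^-1` [set v | E (tau s u') v].
      by apply/seteqP; split=> x /= /IHn.
    exact: counting_tau.
  have bE : blue_stub_left E' v' <-> blue_stub_left E (tau s v').
    rewrite /blue_stub_left;
      have -> : [set v | E' v v'] = tau s @^-1` [set v | E v (tau s v')].
      by apply/seteqP; split=> x /= /IHn.
    exact: counting_tau.
  split=> -[ru bv su sv nE]; split=> //.
  - exact: rE.1 su.
  - exact: bE.1 sv.
  - by move=> /IHn.
  - exact: rE.2 su.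
  - exact: bE.2 sv.
  - by move=> /IHn.
have mcE : mutually_closest (translate s r) (translate s b) E' u v <->
    mutually_closest r b E (tau s u) (tau s v).
  split=> -[/compE cuv cl1 cl2]; split => //.
  - move=> v' cuv' vv'; rewrite -(tauNK s v') !dist_tau; apply: cl1.
      by apply/compE; rewrite tauNK.
    by move=> e; apply: vv'; rewrite -e tauNK.
  - move=> u' cuv' uu'; rewrite -(tauNK s u') !dist_tau; apply: cl2.
      by apply/compE; rewrite tauNK.
    by move=> e; apply: uu'; rewrite -e tauNK.
  - move=> v' /compE cuv' vv'; rewrite -(dist_tau s u v) -(dist_tau s u v');
      apply: cl1 => //.
    by move=> /(can_inj (tauK s)).
  - move=> u' /compE cuv' uu'; rewrite -(dist_tau s u v) -(dist_tau s u' v);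
      apply: cl2 => //.
    by move=> /(can_inj (tauK s)).
by split=> -[/IHn|/mcE]; [left|right|left|right].
Qed.

Lemma stable_multi_matching_translate s r b u v :
  stable_multi_matching (translate s r) (translate s b) u v <->
  stable_multi_matching r b (tau s u) (tau s v).
Proof. by split=> -[n En]; exists n; exact/matching_stage_translate. Qed.

End translation.

Section matching_graph.
Context (R : realType).
Implicit Types (r b : set (marked_point R)).

(** Position and colour of a vertex of the matching graph. *)
Definition vertex_pos (a : vertex R) : R :=
  match a with inl u => u.1 | inr v => v.1 end.

Definition vertex_is_red (a : vertex R) : bool := if a is inl _ then true else false.

(** No two points share a position, and bounded regions contain finitely many
   points. *)
Definition simple_locally_finite r :=
  (forall u v, r u -> r v -> u.1 = v.1 -> u = v) /\
  (forall N : R, finite_set [set u | r u /\ `|u.1| <= N]).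

Definition matching_adjacent r b :=
  adjacent (stable_multi_matching r b).

Definition matching_right_end r b :=
  right_end vertex_pos (vertices r b) (matching_adjacent r b).

Lemma stable_multi_matching_color r b u v :
  stable_multi_matching r b u v -> r u /\ b v.
Proof. by case=> n /matching_stage_compatible[m [[]]]. Qed.

Lemma inl_vertices r b u : vertices r b (inl u) <-> r u.
Proof. by split; [move=> [] [] // ? ? [<-]|move=> ru; left; exists u]. Qed.

Lemma inr_vertices r b v : vertices r b (inr v) <-> b v.
Proof. by split; [move=> [] [] // ? ? [<-]|move=> ru; right; exists v]. Qed.

Lemma matching_adjacentC r b x y :
  matching_adjacent r b x y -> matching_adjacent r b y x.
Proof. by case: x => u; case: y. Qed.

Lemma matching_adjacentP r b x y : matching_adjacent r b x y ->
  [/\ vertices r b x, vertices r b y & vertex_is_red x != vertex_is_red y].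
Proof.
by case: x => u; case: y => v //= h; have [ru bv] := stable_multi_matching_color h;
  split => //; by [apply/inl_vertices|apply/inr_vertices].
Qed.

Section regular_colours.
Variables (r b : set (marked_point R)).
Hypotheses (gr : simple_locally_finite r) (gb : simple_locally_finite b).

Lemma vertex_pos_inj x y : vertices r b x -> vertices r b y ->
  vertex_is_red x = vertex_is_red y -> vertex_pos x = vertex_pos y -> x = y.
Proof.
case: x => u; case: y => v //=.
- by move=> /inl_vertices ru /inl_vertices rv _ /(gr.1 _ _ ru rv) ->.
- by move=> /inr_vertices ru /inr_vertices rv _ /(gb.1 _ _ ru rv) ->.
Qed.

Lemma matching_adjacent_stable x y : vertices r b x -> vertices r b y ->
  vertex_is_red x != vertex_is_red y ->
  [\/ matching_adjacent r b x y,
      (forall z, matching_adjacent r b x z ->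
         `|vertex_pos x - vertex_pos z| <= `|vertex_pos x - vertex_pos y|) |
      (forall z, matching_adjacent r b y z ->
         `|vertex_pos y - vertex_pos z| <= `|vertex_pos x - vertex_pos y|)].
Proof.
case: x => u; case: y => v //.
- move=> /inl_vertices ru /inr_vertices bv _.
  have [h|h|h] := stable_multi_matching_stable ru bv; first by constructor 1.
  + by constructor 2 => -[//|z] /h.
  + by constructor 3 => -[z|//] /h; rewrite /dist /= distrC.
- move=> /inr_vertices bu /inl_vertices rv _.
  have [h|h|h] := stable_multi_matching_stable rv bu; first by constructor 1.
  + by constructor 3 => -[//|z] /h; rewrite /dist /= [leRHS]distrC.
  + by constructor 2 => -[z|//] /h; rewrite /dist /= distrC [leRHS]distrC.
Qed.

Lemma vertices_locally_finite (N : R) :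
  finite_set [set x | vertices r b x /\ `|vertex_pos x| <= N].
Proof.
rewrite (_ : [set x | _] = (inl @` [set u | r u /\ `|u.1| <= N]) `|`
   (inr @` [set u | b u /\ `|u.1| <= N])).
  by rewrite finite_setU; split; apply: finite_image; [exact: gr.2|exact: gb.2].
apply/seteqP; split => [[u|u] /= [/[swap] uN]|x [[u [ru uN] <-]|[u [ru uN] <-]]].
- by move=> /inl_vertices ?; left; exists u.
- by move=> /inr_vertices ?; right; exists u.
- by split => //; apply/inl_vertices.
- by split => //; apply/inr_vertices.
Qed.

Lemma matching_right_end_unique x y :
  matching_right_end r b x -> matching_right_end r b y ->
  vertex_pos x = vertex_pos y.
Proof.
apply: right_end_unique; [exact: matching_adjacentC|exact: matching_adjacentP|
  exact: vertex_pos_inj|exact: matching_adjacent_stable].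
Qed.

Lemma infinite_components_subset1 : (forall x, ~ matching_right_end r b x) ->
  is_subset1 (infinite_components r b (stable_multi_matching r b)).
Proof.
move=> nre _ _ [[x vx <-] ix] [[y vy <-] iy].
have aC := @matching_adjacentC r b; have aP := @matching_adjacentP r b.
have unb z : vertices r b z -> _ := @infinite_unbounded _ _ _ _ _ _ aP
  vertices_locally_finite z.
have [xy|nxy] := pselect (clos_refl_trans _ (matching_adjacent r b) x y).
  apply/seteqP; split => z /= xz.
  - exact: rt_trans (conn_sym aC xy) xz.
  - exact: rt_trans xy xz.
have [m rem] := two_components_right_end aC aP vertex_pos_inj
  matching_adjacent_stable vertices_locally_finite vx vy (unb _ vx ix)
  (unb _ vy iy) nxy.
by case: (nre m).
Qed.

End regular_colours.

(** The matching graph of [c] has a right end in [t, t + 1). *)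
Definition right_end_in (t : R) (c : set (marked_point R) * set (marked_point R)) :=
  exists2 x, matching_right_end c.1 c.2 x & t <= vertex_pos x < t + 1.

Lemma right_end_in_disjoint r b s t :
  simple_locally_finite r -> simple_locally_finite b ->
  right_end_in s (r, b) -> right_end_in t (r, b) -> s + 1 <= t -> False.
Proof.
move=> gr gb [x rx /andP[sx xs]] [y ry /andP[ty yt]] st.
by have := matching_right_end_unique gr gb rx ry; lra.
Qed.

Let vtau s (x : vertex R) : vertex R :=
  match x with inl u => inl (u.1 - s, u.2) | inr u => inr (u.1 - s, u.2) end.

Let vtauK s : cancel (vtau s) (vtau (- s)).
Proof. by case=> [] [x k]; rewrite /vtau /= opprK subrK. Qed.

Let vtauNK s : cancel (vtau (- s)) (vtau s).
Proof. by case=> [] [x k]; rewrite /vtau /= opprK addrK. Qed.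

Let vertex_pos_vtau s x : vertex_pos (vtau s x) = vertex_pos x - s.
Proof. by case: x. Qed.

Let vertices_vtau s r b x :
  vertices (translate s r) (translate s b) x <-> vertices r b (vtau s x).
Proof.
by case: x => u; [rewrite [vtau _ _]/= !inl_vertices|rewrite [vtau _ _]/= !inr_vertices].
Qed.

Lemma conn_translate s r b x y :
  clos_refl_trans _ (matching_adjacent (translate s r) (translate s b)) x y <->
  clos_refl_trans _ (matching_adjacent r b) (vtau s x) (vtau s y).
Proof.
have adjE x' y' : matching_adjacent (translate s r) (translate s b) x' y' <->
    matching_adjacent r b (vtau s x') (vtau s y').
  case: x' => u; case: y' => v //=; exact: stable_multi_matching_translate.
split.
  elim=> [x' y' /adjE|x'|x' y' z' _ xy _ yz]; [exact: rt_step|exact: rt_refl|].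
  exact: rt_trans xy yz.
rewrite -{2}(vtauK s x) -{2}(vtauK s y).
move: (vtau s x) (vtau s y) => {}x {}y.
elim=> [x' y' xy|x'|x' y' z' _ xy _ yz]; last exact: rt_trans xy yz.
  2: exact: rt_refl.
by apply/rt_step/adjE; rewrite !vtauNK.
Qed.

Lemma right_end_in_translate s t r b :
  right_end_in (t + s) (translate s r, translate s b) <-> right_end_in t (r, b).
Proof.
split=> -[x [vx mx ux] /andP[tx xt]].
- exists (vtau s x); last by rewrite vertex_pos_vtau; lra.
  split => /=; first exact/vertices_vtau.
  + move=> y xy; rewrite vertex_pos_vtau.
    have := mx (vtau (- s) y); rewrite vertex_pos_vtau => h.
    suff /h : clos_refl_trans _ (matching_adjacent (translate s r)
        (translate s b)) x (vtau (- s) y) by lra.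
    by apply/conn_translate; rewrite vtauNK.
  + move=> N; have [y xy yN] := ux (N + s); exists (vtau s y).
      exact/conn_translate.
    by rewrite vertex_pos_vtau; lra.
- exists (vtau (- s) x); last by rewrite vertex_pos_vtau; lra.
  split => /=; first by apply/vertices_vtau; rewrite vtauNK.
  + move=> y /conn_translate; rewrite vtauNK => /mx.
    by rewrite !vertex_pos_vtau; lra.
  + move=> N; have [y xy yN] := ux (N - s); exists (vtau (- s) y).
      by apply/conn_translate; rewrite !vtauNK.
    by rewrite vertex_pos_vtau; lra.
Qed.

End matching_graph.

(** * Probabilistic preliminaries *)

Section probability_preliminaries.
Context (d : measure_display) (T : measurableType d) (R : realType).
Variable P : probability T R.

Lemma ae_eq_prob (A B : set T) : measurable A -> measurable B ->
  {ae P, forall w, A w <-> B w} -> P A = P B.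
Proof.
move=> mA mB [N [mN N0 hN]].
have H (C D : set T) : measurable C -> measurable D ->
    (forall w, C w -> D w \/ N w) -> (P C <= P D)%E.
  move=> mC mD CD; have -> : P D = (P D + P N)%E by rewrite N0 adde0.
  apply: le_trans (measureU2 _ mD mN); apply: le_measure; rewrite ?inE//.
  exact: measurableU.
apply/eqP; rewrite eq_le; apply/andP; split; apply: H => // w Cw.
- have [[AB _]|nAB] := pselect (A w <-> B w); [by left; exact: AB|right; exact: hN].
- have [[_ BA]|nAB] := pselect (A w <-> B w); [by left; exact: BA|right; exact: hN].
Qed.

Lemma total_probability (I : countType) (B : I -> set T) (A : set T) :
  (forall i, measurable (B i)) -> trivIset setT B ->
  {ae P, forall w, exists i, B i w} -> measurable A ->
  P A = (\sum_(n <oo) P (if pickle_inv n is Some i then A `&` B i else set0))%E.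
Proof.
move=> mB tB cB mA.
pose F n := if @pickle_inv I n is Some i then A `&` B i else set0.
have mF n : measurable (F n).
  by rewrite /F; case: pickle_inv => // i; exact: measurableI.
rewrite -(@measure_semi_bigcup _ _ _ P F) //.
- apply: ae_eq_prob => //; first exact: bigcupT_measurable.
  apply: filterS cB => w [i Biw]; split=> [Aw|[n _]].
    by exists (pickle i) => //; rewrite /F pickleK_inv.
  by rewrite /F; case: pickle_inv => // j [].
- move=> m n _ _ [w []]; rewrite /F.
  have := @pickle_invK I m; have := @pickle_invK I n.
  case: pickle_inv => [j|] //= jn; case: pickle_inv => [i|] //= im [_ Bi] [_ Bj].
  by rewrite -jn -im; congr pickle; apply: tB => //; exists w.
- exact: bigcupT_measurable.
Qed.

Lemma sigma_rvsP (I : Type) (D : set I) d' (T' : measurableType d')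
  (f : I -> T -> T') i (B : set T') : D i -> measurable B ->
  sigma_rvs D f (f i @^-1` B).
Proof.
move=> Di mB; apply: sub_sigma_algebra; exists i => //.
by exists B => //; rewrite setTI.
Qed.

Lemma sigma_rvs_bigcap (I : Type) (D : set I) d' (T' : measurableType d')
  (f : I -> T -> T') (F : nat -> set T) :
  (forall n, sigma_rvs D f (F n)) -> sigma_rvs D f (\bigcap_n F n).
Proof.
move=> h; pose G := \bigcup_(i in D) sigma_rv (f i).
exact: (@bigcapT_measurable _ (g_sigma_algebraType G)).
Qed.

End probability_preliminaries.

(** Comparison of two probabilities piece by piece along two countable almost
   sure partitions with the same index type. *)
Lemma total_probability_eq (d : measure_display) (T : measurableType d)
  (R : realType) (P : probability T R)
  (d' : measure_display) (T' : measurableType d') (P' : probability T' R)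
  (I : countType) (B : I -> set T) (B' : I -> set T') (A : set T) (A' : set T') (c : R) :
  (forall i, measurable (B i)) -> trivIset setT B ->
  {ae P, forall w, exists i, B i w} -> measurable A ->
  (forall i, measurable (B' i)) -> trivIset setT B' ->
  {ae P', forall w, exists i, B' i w} -> measurable A' ->
  (forall i, P (A `&` B i) = c%:E * P' (A' `&` B' i))%E ->
  P A = (c%:E * P' A')%E.
Proof.
move=> mB tB cB mA mB' tB' cB' mA' h.
rewrite (total_probability mB tB cB mA) (total_probability mB' tB' cB' mA').
rewrite -nneseriesZl//; apply: eq_eseriesr => n _.
by case: pickle_inv => [i|]; [exact: h|rewrite !measure0 mule0].
Qed.

Lemma prod_count_mem (R : realType) (I : finType) (h : option I -> R) (f : seq (option I)) :
  h None = 1 -> \prod_(y <- f) h y = \prod_i h (Some i) ^+ count_mem (Some i) f.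
Proof.
move=> h1; elim: f => [|y f IHf]; first by rewrite big_nil big1.
rewrite big_cons IHf; case: y => [j|] /=.
- rewrite (bigD1 j)//= [RHS](bigD1 j)//= eqxx exprS mulrA; congr (_ * _).
  apply: eq_bigr => i ij; rewrite (_ : (Some j == Some i) = false) ?add0n//.
  by apply/eqP => -[/esym/eqP]; apply/negP.
- by rewrite h1 mul1r; apply: eq_bigr => i _; rewrite add0n.
Qed.

(** A trimmed sequence does not end with [None]: it is determined by its values,
   read with the default [None], and codes an eventually [None] sequence. *)
Definition trimmed (I : eqType) (f : seq (option I)) :=
  (f == [::]) || (last None f != None).

Lemma trimmed_inj (I : eqType) (f g : seq (option I)) : trimmed f -> trimmed g ->
  (forall n, nth None f n = nth None g n) -> f = g.
Proof.
move=> tf tg fg.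
have H (f' g' : seq (option I)) : trimmed g' ->
    (forall n, nth None f' n = nth None g' n) -> (size g' <= size f')%N.
  move=> tg' fg'; rewrite leqNgt; apply/negP => fg_lt.
  move: tg'; rewrite /trimmed -size_eq0 -leqn0 leqNgt (leq_ltn_trans _ fg_lt)//=.
  by rewrite -nth_last -fg' nth_default ?eqxx// -ltnS prednK// (leq_ltn_trans _ fg_lt).
apply: (@eq_from_nth _ None) => //.
by apply/eqP; rewrite eqn_leq !H.
Qed.

Lemma trimmedP (I : eqType) (y : nat -> option I) (N : nat) :
  (forall n, (N <= n)%N -> y n = None) ->
  exists2 f, trimmed f & forall n, nth None f n = y n.
Proof.
elim: N => [|N IHN] h; first by exists [::] => // n; rewrite nth_nil h.
have [yN|yN] := eqVneq (y N) None.
  by apply: IHN => n; rewrite leq_eqVlt => /predU1P[<-//|]; exact: h.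
exists (mkseq y N.+1).
  by rewrite /trimmed -nth_last size_mkseq nth_mkseq// yN orbT.
by move=> n; have [nN|nN] := ltnP n N.+1;
  [rewrite nth_mkseq|rewrite nth_default ?size_mkseq// h].
Qed.

(** * Void probabilities of an independently marked Poisson process *)

Section poisson_counts.
Context (d : measure_display) (T : measurableType d) (R : realType).
Variables (P : probability T R) (lambda : R) (lambda_gt0 : 0 < lambda).
Variable (Phi : T -> set R).
Hypothesis Phi_poisson : homogeneous_poisson P lambda Phi.

Lemma measurable_count (A : set R) (x : \bar R) : measurable A ->
  measurable [set w | count R Phi A w = x].
Proof.
move=> mA; have [h _ _] := Phi_poisson.
by have := h A mA measurableT [set x]; rewrite setTI; apply.
Qed.

(** The Poisson weights add up to 1. *)
Lemma count_finite (A : set R) : measurable A -> (lebesgue_measure A < +oo)%E ->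
  {ae P, forall w, exists k : nat, count R Phi A w = k%:R%:E}.
Proof.
move=> mA fA; have [_ law _] := Phi_poisson.
pose F (k : nat) := [set w | count R Phi A w = k%:R%:E].
have mF k : measurable (F k) by exact: measurable_count.
have tF : trivIset setT F.
  move=> i j _ _ [w [Fi Fj]]; move: Fi; rewrite /F /= Fj => -[] /eqP.
  by rewrite eqr_nat => /eqP.
suff PF : P (\bigcup_k F k) = 1%E.
  exists (~` \bigcup_k F k); split; first exact/measurableC/bigcupT_measurable.
    by rewrite probability_setC ?PF ?subee//; exact: bigcupT_measurable.
  by move=> w nw [k _ Fk]; apply: nw; exists k.
set rate := lambda * fine (lebesgue_measure A).
have Fk k : P (F k) = (rate ^+ k / k`!%:R * expR (- rate))%:E by exact: law.
have mUF : measurable (\bigcup_k F k) by exact: bigcupT_measurable.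
have : 0 <= rate by apply: mulr_ge0; [exact: ltW|exact: fine_ge0].
rewrite le_eqVlt => /predU1P[rate0|rate_gt0].
- apply/eqP; rewrite eq_le probability_le1//=.
  have <- : P (F 0%N) = 1%E.
    by rewrite Fk -rate0 oppr0 expR0 expr0 fact0 divr1 mulr1.
  by apply: le_measure; rewrite ?inE//; exact: bigcup_sup.
- rewrite measure_semi_bigcup//.
  have <- : poisson_prob rate 0 setT = 1%E by exact: probability_setT.
  rewrite /poisson_prob rate_gt0 -nneseries_esumT; last first.
    by move=> k; rewrite lee_fin poisson_pmf_ge0.
  apply: eq_eseriesr => k _; apply: etrans (Fk k) _.
  by rewrite /poisson_pmf rate_gt0.
Qed.

End poisson_counts.

Section void_probabilities.
Context (d : measure_display) (T : measurableType d) (R : realType).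
Variables (P : probability T R) (lambda : R) (lambda_gt0 : 0 < lambda).
Variables (nu : probability nat R) (xi : T -> set (marked_point R)).
Hypothesis xi_law : marked_poisson P lambda nu xi.
Variable I : finType.

(** [c] cuts the line into measurable cells of finite length, indexed by a
   finite type, and a remainder, on which it is [None]. *)
Definition finite_cells (c : R -> option I) := forall i,
  measurable (c @^-1` [set Some i]) /\
  (lebesgue_measure (c @^-1` [set Some i]) < +oo)%E.

(** The points of the cell [i] whose mark is in [S i], for all [i]. *)
Definition marked_cells (c : R -> option I) (S : I -> set nat) :
    set (marked_point R) :=
  [set u | exists2 i, c u.1 = Some i & S i u.2].

Lemma measurable_marked_cells c S : finite_cells c -> measurable (marked_cells c S).
Proof.
move=> mc; rewrite (_ : marked_cells c S =
    \bigcup_(i in [set: I]) ((c @^-1` [set Some i]) `*` S i)).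
  apply: fin_bigcup_measurable => [|i _]; first exact: finite_finset.
  by apply: measurableX => //; exact: (mc i).1.
apply/seteqP; split=> [u [i ci Si]|u [i _ [/= ci Si]]].
  by exists i.
by exists i.
Qed.

Variables (c : R -> option I) (S : I -> set nat).
Hypothesis mc : finite_cells c.

Local Notation Phi := (fun w => fst @` xi w).
Local Notation cell i := (c @^-1` [set Some i]).
Local Notation void := [set w | xi w `&` marked_cells c S = set0].

(** The event that the cell [i] contains [v i] points, for all [i]. *)
Definition cell_counts (v : {ffun I -> nat}) :=
  [set w | forall i, count R Phi (cell i) w = (v i)%:R%:E].

Lemma measurable_void : measurable void.
Proof.
have [h _ _] := xi_law.
have := h _ (measurable_marked_cells S mc) measurableT [set 0%E].
by rewrite setTI -void_eventE; apply.
Qed.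

Lemma measurable_cell y : measurable (c @^-1` [set y]).
Proof.
case: y => [i|]; first exact: (mc i).1.
rewrite (_ : c @^-1` _ = ~` \bigcup_(i in [set: I]) cell i).
  apply: measurableC; apply: fin_bigcup_measurable => [|i _];
    first exact: finite_finset.
  exact: (mc i).1.
apply/seteqP; split => [x /= cx [i _ /=]|x]; first by rewrite cx.
by move=> /= h; case E : (c x) => [i|//]; case: h; exists i.
Qed.

Lemma measurable_cell_counts v : measurable (cell_counts v).
Proof.
rewrite (_ : cell_counts v = \bigcap_n
   (if @pickle_inv I n is Some i then
      [set w | count R Phi (cell i) w = (v i)%:R%:E] else setT)).
  apply: bigcapT_measurable => n; case: pickle_inv => // i.
  by have [_ h _] := xi_law; exact: (measurable_count h _ (mc i).1).
apply/seteqP; split=> w h => [n _|i].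
  by case: pickle_inv => // i; exact: h.
by have := h (pickle i) Logic.I; rewrite pickleK_inv.
Qed.

Lemma trivIset_cell_counts : trivIset setT cell_counts.
Proof.
move=> u v _ _ [w [uw vw]]; apply/ffunP => i.
by have := uw i; rewrite vw => -[] /eqP; rewrite eqr_nat => /eqP.
Qed.

Lemma cell_counts_cover : {ae P, forall w, exists v, cell_counts v w}.
Proof.
have [_ h _] := xi_law.
have : {ae P, forall w, forall n, if @pickle_inv I n is Some i then
    exists k : nat, count R Phi (cell i) w = k%:R%:E else True}.
  apply/ae_foralln => n; case: pickle_inv => [i|]; last exact: aeW.
  exact: (count_finite lambda_gt0 h (mc i).1 (mc i).2).
apply: filterS => w hw.
have /choice[v hv] i : exists k : nat, count R Phi (cell i) w = k%:R%:E.
  by have := hw (pickle i); rewrite pickleK_inv.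
by exists [ffun i => v i] => i; rewrite ffunE.
Qed.

Lemma prob_cell_counts v : P (cell_counts v) = (\prod_i
  (let rate := (lambda * fine (lebesgue_measure (cell i)))%R in
   (rate ^+ v i / (v i)`!%:R * expR (- rate))%R%:E))%E.
Proof.
have [_ hP _] := xi_law; have [_ law ind] := hP.
pose A n : set R := if @pickle_inv I n is Some i then cell i else set0.
have mA n : measurable (A n).
  by rewrite /A; case: pickle_inv => // i; exact: (mc i).1.
have tA : trivIset setT A.
  move=> m n _ _ [w []]; rewrite /A.
  have := @pickle_invK I m; have := @pickle_invK I n.
  case: pickle_inv => [j|] //= jn; case: pickle_inv => [i|] //= im.
  by rewrite -jn -im => -> [->].
pose E n : set T := if @pickle_inv I n is Some i then
   [set w | count R Phi (cell i) w = (v i)%:R%:E] else setT.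
have := ind A mA tA (map pickle (enum I)) E.
rewrite big_map big_enum/= => H;
  transitivity (P (\bigcap_(i in [set` [seq pickle i | i <- enum I]]) E i)).
  congr (P _); apply/seteqP; split => w /= h.
    by move=> n /= /mapP[i _ ->]; rewrite /E pickleK_inv; exact: h.
  move=> i; have := h (pickle i); rewrite /E pickleK_inv; apply.
  by apply: map_f; rewrite mem_enum.
rewrite H.
- apply: eq_bigr => i _; rewrite /E pickleK_inv; apply: law;
    [exact: (mc i).1|exact: (mc i).2].
- by rewrite map_inj_uniq ?enum_uniq//; exact: pcan_inj pickleK_inv.
- move=> n /mapP[i _ ->]; rewrite /E /A pickleK_inv.
  by exists [set (v i)%:R%:E] => //; rewrite setTI.
Qed.

(** The probability that the mark of a point of the cell [y] is allowed. *)
Definition avoid_weight (y : option I) : R :=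
  if y is Some i then fine (nu (~` S i)) else 1.

(** Given the numbers of points in the cells, each point avoids the forbidden
   marks independently of the others. The event is decomposed according to the
   sequence of the cells of the points X_0, X_1, ...; almost surely it is
   eventually [None], so it takes countably many values, coded by trimmed
   sequences. Given its value, the event is a conjunction of conditions on
   finitely many marks, which are independent of the sequence X. *)
Lemma prob_void_cell_counts v :
  P (void `&` cell_counts v) =
  ((\prod_i avoid_weight (Some i) ^+ v i)%:E * P (cell_counts v))%E.
Proof.
have mcell := measurable_cell; have [_ _ [X [D [XD Dnu ind]]]] := xi_law.
pose B (f : seq (option I)) := if trimmed f then
  \bigcap_n (X n @^-1` (c @^-1` [set nth None f n])) else set0.
have sB f : trimmed f -> sigma_rvs setT (fun n => X n : T -> R) (B f).
  move=> tf; rewrite /B tf; apply: sigma_rvs_bigcap => n.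
  exact: (@sigma_rvsP _ _ _ setT _ _ (fun n => X n : T -> R)).
have mB f : measurable (B f).
  rewrite /B; case: ifP => // tf; apply: bigcapT_measurable => n.
  by rewrite -[X in measurable X]setTI; exact: measurable_funP.
have tB : trivIset setT B.
  move=> f g _ _ [w []]; rewrite /B; case: ifP => // tf hf; case: ifP => // tg hg.
  apply: trimmed_inj => // n.
  by have /= <- := hf n Logic.I; have /= <- := hg n Logic.I.
(* On [B f], the counts are read off [f], and only the first [size f] points
   can be in a cell. *)
have good : {ae P, forall w, forall f, B f w ->
    (forall i, count R Phi (cell i) w = (count_mem (Some i) f)%:R%:E) /\
    (void w <-> forall n, (n < size f)%N ->
      if nth None f n is Some i then ~ S i (D n w) else True)}.
  apply: filterS XD => w [Xinj xiE] f; rewrite /B; case: ifP => // tf hf.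
  have {}hf n : c (X n w) = nth None f n by exact: hf n Logic.I.
  split.
  - move=> i; rewrite /count.
    pose s := [seq X n w | n <- iota 0 (size f) & nth None f n == Some i].
    have -> : Phi w `&` cell i = [set` s].
      apply/seteqP; split => x /=.
        rewrite xiE => -[[_ [n _ <-] <-] /= ci]; apply/mapP; exists n => //.
        rewrite mem_filter mem_iota /= add0n -hf ci eqxx /=.
        by rewrite ltnNge; apply/negP => nf; move: ci; rewrite hf nth_default.
      move=> /mapP[n]; rewrite mem_filter => /andP[/eqP fn _] ->; split.
        by rewrite xiE; exists (X n w, D n w) => //; exists n.
      by rewrite hf.
    rewrite counting_seq.
      rewrite size_map size_filter; congr (_%:R%:E).
      rewrite -[in RHS](mkseq_nth None f) /mkseq count_map.
      by apply: eq_count => n.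
    by rewrite map_inj_uniq// filter_uniq// iota_uniq.
  - split.
    + move=> vw n _; case fn : nth => [i|//] Si.
      suff : (xi w `&` marked_cells c S) (X n w, D n w) by rewrite vw.
      split; first by rewrite xiE; exists n.
      by exists i => //=; rewrite hf.
    + move=> h; apply/seteqP; split => // u [];
        rewrite xiE => -[n _ <-] [i /= ci Si].
      have nf : (n < size f)%N.
        by rewrite ltnNge; apply/negP => nf; move: ci; rewrite hf nth_default.
      by have := h n nf; rewrite -hf ci.
have cB : {ae P, forall w, exists f, B f w}.
  apply: filterS2 XD cell_counts_cover => w [Xinj xiE] [u hu].
  have fin : finite_set [set n | c (X n w) <> None].
    pose A := \bigcup_(i in [set: I]) (Phi w `&` cell i).
    have fA : finite_set A.
      apply: bigcup_finite; first exact: finite_finset.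
      by move=> i _; have := hu i; rewrite /count /counting; case: asboolP.
    apply: (@sub_finite_set _ _ (X ^~ w @^-1` A)).
      move=> n /= cn; case ci : (c (X n w)) cn => [i|//] _; exists i => //;
        split=> //.
      by rewrite xiE; exists (X n w, D n w) => //; exists n.
    by apply: finite_preimage => // m n _ _; exact: Xinj.
  have [N hN] : exists N, forall n, (N <= n)%N -> c (X n w) = None.
    exists (\max_(n <- fset_set [set n | c (X n w) <> None]) n).+1 => n Nn.
    apply: contrapT => cn; move: Nn; rewrite ltnNge => /negP; apply.
    by apply: leq_bigmax_seq => //; rewrite in_fset_set// inE.
  have [f tf hf] := trimmedP hN.
  by exists f; rewrite /B tf => n _ /=; rewrite hf.
have weightE y : (avoid_weight y)%:E = nu (if y is Some i then ~` S i else setT).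
  by case: y => [i|] /=; rewrite ?fineK ?fin_num_measure// probability_setT.
have mvoid := measurable_void.
have voidB f : trimmed f ->
    P (void `&` B f) = ((\prod_(y <- f) avoid_weight y)%:E * P (B f))%E.
  move=> tf.
  pose E (o : option nat) : set T := if o is Some n then
    D n @^-1` (if nth None f n is Some i then ~` S i else setT) else B f.
  pose J := None :: map Some (iota 0 (size f)).
  have uJ : uniq J.
    rewrite /= map_inj_uniq ?iota_uniq ?andbT; last by move=> ? ? [].
    by apply/negP => /mapP[].
  have mE o : measurable (E o).
    case: o => [n|]; last exact: mB.
    by rewrite -[X in measurable X]setTI; exact: measurable_funP.
  transitivity (P (\bigcap_(o in [set` J]) E o)).
    apply: ae_eq_prob; [exact: measurableI|exact: fin_bigcap_measurable|].
    apply: filterS good => w gw; split.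
      move=> [vw Bw]; have [_ [/(_ vw) h _]] := gw f Bw.
      move=> [n|] //=; rewrite inE /= => /mapP[m];
        rewrite mem_iota/= add0n => mf [->].
      by have := h m mf; case: nth.
    move=> h; have Bw : B f w by apply: (h None); rewrite /= inE eqxx.
    split=> //; have [_ [_]] := gw f Bw; apply => n nf.
    have := h (Some n); rewrite /E /=.
    case: nth => [i|//]; apply.
    by rewrite inE /=; apply: map_f; rewrite mem_iota.
  rewrite ind//; last first.
    move=> [n|] _ /=.
      exists (if nth None f n is Some i then ~` S i else setT) => //.
      by rewrite setTI.
    exact: sB.
  rewrite /J big_cons big_map muleC; congr (_ * _)%E.
  rewrite -prodEFin -[in RHS](mkseq_nth None f) /mkseq big_map.
  by apply: eq_bigr => n _; rewrite weightE -(Dnu n).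
have mcv : measurable (cell_counts v) by exact: measurable_cell_counts.
have mvc : measurable (void `&` cell_counts v) by exact: measurableI.
apply: (total_probability_eq (B := B) (B' := B)) => //.
move=> f; have [tf|ntf] := boolP (trimmed f); last first.
  by rewrite /B (negbTE ntf) !setI0 measure0 mule0.
have [fv|fv] := pselect (forall i, v i = count_mem (Some i) f).
- transitivity (P (void `&` B f)).
    apply: ae_eq_prob; [exact: measurableI|exact: measurableI|].
    apply: filterS good => w gw; split=> [[[]]|[vw Bw]] //; split=> //; split=> //.
    by move=> i; rewrite fv; exact: (gw f Bw).1.
  rewrite voidB// prod_count_mem//; congr (_%:E * _)%E.
    by apply: eq_bigr => i _; rewrite fv.
  apply: ae_eq_prob; [exact: mB|exact: measurableI|].
  apply: filterS good => w gw; split=> [Bw|[]] //; split=> // i.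
  by rewrite fv; exact: (gw f Bw).1.
- have H A : measurable A -> A `<=` cell_counts v -> P (A `&` B f) = 0%E.
    move=> mA Av; rewrite -(measure0 P); apply: ae_eq_prob => //;
      first exact: measurableI.
    apply: filterS good => w gw; split=> // -[/Av vw Bw]; apply: fv => i.
    by have := (gw f Bw).1 i; rewrite vw => -[] /eqP; rewrite eqr_nat => /eqP.
  by rewrite !H ?mule0// => w [].
Qed.

End void_probabilities.

Lemma void_probability_eq (d : measure_display) (T : measurableType d)
  (R : realType) (P : probability T R) (lambda : R) (nu : probability nat R)
  (xi : T -> set (marked_point R)) (I : finType) (c c' : R -> option I)
  (S : I -> set nat) : 0 < lambda -> marked_poisson P lambda nu xi ->
  finite_cells c -> finite_cells c' ->
  (forall i, lebesgue_measure (c @^-1` [set Some i]) =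
             lebesgue_measure (c' @^-1` [set Some i])) ->
  P [set w | xi w `&` marked_cells c S = set0] =
  P [set w | xi w `&` marked_cells c' S = set0].
Proof.
move=> l0 xi_law mc mc' cc'; rewrite -[RHS]mul1e.
apply: (total_probability_eq (B := cell_counts xi c) (B' := cell_counts xi c')).
- exact: (measurable_cell_counts xi_law mc).
- exact: trivIset_cell_counts.
- exact: (cell_counts_cover l0 xi_law mc).
- exact: (measurable_void xi_law S mc).
- exact: (measurable_cell_counts xi_law mc').
- exact: trivIset_cell_counts.
- exact: (cell_counts_cover l0 xi_law mc').
- exact: (measurable_void xi_law S mc').
- move=> v; rewrite mul1e (prob_void_cell_counts l0 xi_law S mc).
  rewrite (prob_void_cell_counts l0 xi_law S mc').
  rewrite (prob_cell_counts xi_law mc) (prob_cell_counts xi_law mc');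
    congr (_ * _)%E.
  by apply: eq_bigr => i _; rewrite cc'.
Qed.

(** * Translation invariance of the joint law *)

Lemma lebesgue_measure_translate (R : realType) (A : set R) (s : R) : measurable A ->
  lebesgue_measure ((fun x => x + s) @^-1` A) = lebesgue_measure A.
Proof.
move=> mA; have mf : measurable_fun setT ((fun x => x + s) : R -> measurableTypeR R).
  exact: measurable_funD.
have -> : lebesgue_measure ((fun x => x + s) @^-1` A) =
    pushforward lebesgue_measure ((fun x => x + s) : R -> measurableTypeR R) A by [].
apply/esym/lebesgue_measure_unique => //= _ [[a b]] _ <-.
rewrite /pushforward (_ : _ @^-1` _ = `]a - s, b - s]%classic).
  rewrite !lebesgue_measure_itv /= !lte_fin ltrD2r; case: ifP => // _.
  by rewrite -!EFinB; congr _%:E; ring.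
by apply/seteqP; split => x /=; rewrite !in_itv /= ltrBlDr lerBrDr.
Qed.

Section configurations.
Context (R : realType).
Notation config := (set (marked_point R) * set (marked_point R))%type.

(** The regions whose void probabilities are compared. *)
Definition cell_union (U : set (marked_point R)) :=
  exists (I : finType) (c : R -> option I) (S : I -> set nat),
    finite_cells c /\ U = marked_cells c S.

Lemma cell_unionU U V : cell_union U -> cell_union V -> cell_union (U `|` V).
Proof.
move=> [I1 [c1 [S1 [mc1 ->]]]] [I2 [c2 [S2 [mc2 ->]]]].
pose I : finType := (option I1 * option I2)%type.
pose c x : option I := if (c1 x, c2 x) is (None, None) then None else Some (c1 x, c2 x).
pose S (y : I) := (if y.1 is Some i then S1 i else set0) `|`
                  (if y.2 is Some i then S2 i else set0).
have cE x y1 y2 : c x = Some (y1, y2) <->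
    [/\ c1 x = y1, c2 x = y2 & (y1, y2) != (None, None)].
  rewrite /c; split; last by move=> [-> ->]; case: y1 => [?|]; case: y2 => [?|].
  by case: (c1 x) => [j1|]; case: (c2 x) => [j2|] //= [<- <-].
exists I, c, S; split; last first.
  apply/seteqP; split => u; rewrite /marked_cells /=.
    move=> [[i ci Si]|[i ci Si]].
    - exists (Some i, c2 u.1); last by left.
      exact/cE.
    - exists (c1 u.1, Some i); last by right.
      by apply/cE; split=> //; case: (c1 u.1).
  move=> [[y1 y2]] /cE[cy1 cy2 _] [|] /=.
    by case: y1 cy1 => // i ci Si; left; exists i.
  by case: y2 cy2 => // i ci Si; right; exists i.
have H y1 y2 : (y1, y2) != (None, None) ->
    c @^-1` [set Some (y1, y2)] = (c1 @^-1` [set y1]) `&` (c2 @^-1` [set y2]).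
  move=> y12; apply/seteqP; split => x /=; first by move/cE => [].
  by move=> [? ?]; exact/cE.
move=> [y1 y2]; have [|y12] := eqVneq (y1, y2) (None, None).
  move=> [-> ->]; rewrite (_ : _ @^-1` _ = set0) ?measure0//.
  by apply/seteqP; split => // x /= /cE[].
rewrite H//; have mH := measurableI _ _ (measurable_cell mc1 y1) (measurable_cell mc2 y2).
split => //; case: y1 y12 mH => [i _ mH|].
  apply: le_lt_trans (mc1 i).2; apply: le_measure; rewrite ?inE//; exact: (mc1 i).1.
case: y2 => [i _ mH|//].
by apply: le_lt_trans (mc2 i).2; apply: le_measure; rewrite ?inE//;
  exact: (mc2 i).1.
Qed.

Lemma cell_union0 : cell_union set0.
Proof.
exists unit, (fun=> None), (fun=> set0); split; last by apply/seteqP;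
  split=> // u [].
by move=> i; rewrite (_ : _ @^-1` _ = set0) ?measure0//; apply/seteqP; split.
Qed.

Lemma cell_union_box (p q : R) (K : set nat) :
  cell_union [set u | p <= u.1 < q /\ K u.2].
Proof.
exists unit, (fun x => if p <= x < q then Some tt else None), (fun=> K); split.
  move=> []; rewrite (_ : _ @^-1` _ = `[p, q[%classic).
    split; first exact: measurable_itv.
    by rewrite lebesgue_measure_itv /=; case: ifP => // _; rewrite -EFinB ltry.
  by apply/seteqP; split=> x /=; rewrite in_itv /=; case: ifP.
apply/seteqP; split=> u; rewrite /marked_cells /=.
  by move=> [-> Ku]; exists tt.
by move=> [[]]; case: ifP.
Qed.

Lemma measurable_cell_union U : cell_union U -> measurable U.
Proof. by move=> [I [c [S [mc ->]]]]; exact: measurable_marked_cells. Qed.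

(** The events that a region contains no red point and another one no blue
   point; they form a pi-system. *)
Definition void_events : set_system config :=
  [set E | exists U V, [/\ cell_union U, cell_union V &
    E = [set c | c.1 `&` U = set0 /\ c.2 `&` V = set0]]].

Lemma void_events_setI : setI_closed void_events.
Proof.
move=> _ _ [U [V [cU cV ->]]] [U' [V' [cU' cV' ->]]].
exists (U `|` U'), (V `|` V'); split; [exact: cell_unionU|exact: cell_unionU|].
apply/seteqP; split => c /=; rewrite !setIUr !setU_eq0; tauto.
Qed.

(** The sigma-algebra of configurations, generated by the void events. *)
Definition config_sigma := <<s void_events >>.

End configurations.

(** A translate of [r] avoids [U] exactly when [r] avoids a translate [V] of [U];
   the cells of [U] and [V] have the same lengths. *)
Lemma marked_poisson_void_translate (d : measure_display) (T : measurableType d)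
  (R : realType) (P : probability T R) (lambda : R) (nu : probability nat R)
  (xi : T -> set (marked_point R)) (s : R) (U : set (marked_point R)) :
  0 < lambda -> marked_poisson P lambda nu xi -> cell_union U ->
  exists V, [/\ measurable V,
    (forall r, translate s r `&` U = set0 <-> r `&` V = set0) &
    P [set w | xi w `&` U = set0] = P [set w | xi w `&` V = set0]].
Proof.
move=> l0 xi_law [I [c [S [mc ->]]]].
have cE i : lebesgue_measure ((c \o (fun x => x + s)) @^-1` [set Some i]) =
    lebesgue_measure (c @^-1` [set Some i]).
  exact: (lebesgue_measure_translate s (mc i).1).
have mc' : finite_cells (c \o (fun x => x + s)).
  move=> i; rewrite cE; split; last exact: (mc i).2.
  have mf : measurable_fun setT (fun x : R => x + s) by exact: measurable_funD.
  by have := mf measurableT _ (mc i).1; rewrite setTI.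
exists (marked_cells (c \o (fun x => x + s)) S); split.
- exact: measurable_marked_cells.
- move=> r; rewrite -!subset0; split=> h u [].
  + move=> ru [i ci Si]; apply: (h (u.1 + s, u.2)); split; last by exists i.
    by rewrite /translate /= addrK -surjective_pairing.
  + move=> ru [i ci Si]; apply: (h (u.1 - s, u.2)); split=> //.
    by exists i => //=; rewrite subrK.
- apply: (void_probability_eq _ l0 xi_law mc mc') => i.
  exact/esym.
Qed.

Section invariance.
Context (d : measure_display) (T : measurableType d) (R : realType).
Variables (P : probability T R) (lr lb : R) (lr0 : 0 < lr) (lb0 : 0 < lb).
Variables (nu mu : probability nat R) (red blue : T -> set (marked_point R)).
Hypotheses (red_law : marked_poisson P lr nu red)
  (blue_law : marked_poisson P lb mu blue)
  (red_blue_indep : independent P (sigma_process R red) (sigma_process R blue)).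

Let sigma_void (xi : T -> set (marked_point R)) (U : set (marked_point R)) :
  measurable U -> sigma_process R xi [set w | xi w `&` U = set0].
Proof. by move=> mU; rewrite (void_eventE R); exact: sigma_rvsP. Qed.

Let measurable_void_event (xi : T -> set (marked_point R)) (U : set (marked_point R)) :
  point_process R xi -> measurable U -> measurable [set w | xi w `&` U = set0].
Proof.
by move=> h mU; rewrite (void_eventE R) -[X in measurable X]setTI; exact: h.
Qed.

(** Translations preserve the law of the pair of processes on the
   sigma-algebra of configurations. *)
Lemma config_law_translate (s : R) (A : set (set (marked_point R) * set (marked_point R))) :
  config_sigma A ->
  [/\ measurable [set w | A (red w, blue w)],
      measurable [set w | A (translate s (red w), translate s (blue w))] &
      P [set w | A (translate s (red w), translate s (blue w))] =
      P [set w | A (red w, blue w)]].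
Proof.
have [pr _ _] := red_law; have [pb _ _] := blue_law.
rewrite /config_sigma -setI_closed_g_dynkin_g_sigma_algebra;
  last exact: void_events_setI.
pose H := [set A : set (set (marked_point R) * set (marked_point R)) |
  [/\ measurable [set w | A (red w, blue w)],
      measurable [set w | A (translate s (red w), translate s (blue w))] &
      P [set w | A (translate s (red w), translate s (blue w))] =
      P [set w | A (red w, blue w)]]].
move=> dA; suff : H A by []; move: A dA.
apply: smallest_sub => [|_ [U [V [cU cV ->]]]]; rewrite /H /=; last first.
  have mU := measurable_cell_union cU; have mV := measurable_cell_union cV.
  have [U' [mU' UU' PU]] := marked_poisson_void_translate s lr0 red_law cU.
  have [V' [mV' VV' PV]] := marked_poisson_void_translate s lb0 blue_law cV.
  have -> : [set w | translate s (red w) `&` U = set0 /\ translate s (blue w) `&` V = set0]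
      = [set w | red w `&` U' = set0] `&` [set w | blue w `&` V' = set0].
    by apply/seteqP; split => w /= [] /UU' ? /VV' ?.
  have -> : [set w | red w `&` U = set0 /\ blue w `&` V = set0]
      = [set w | red w `&` U = set0] `&` [set w | blue w `&` V = set0] by [].
  split; [by apply: measurableI; exact: measurable_void_event ..|].
  rewrite !red_blue_indep ?PU ?PV//; exact: sigma_void.
split.
- by split; [exact: measurableT ..|].
- move=> A [m1 m2 PA]; split; [exact: measurableC ..|].
  rewrite (_ : [set w | (~` A) (translate _ _, _)] =
    ~` [set w | A (translate s (red w), translate s (blue w))])//.
  rewrite (_ : [set w | (~` A) _] = ~` [set w | A (red w, blue w)])//.
  by rewrite !probability_setC// PA.
- move=> F tF hF.
  have tZ Z : trivIset setT (fun n => [set w : T | F n (Z w)]).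
    by move=> i j _ _ [w [Fi Fj]]; apply: tF => //; exists (Z w).
  have m1 : measurable (\bigcup_n [set w | F n (red w, blue w)]).
    by apply: bigcupT_measurable => n; have [] := hF n.
  have m2 : measurable
      (\bigcup_n [set w | F n (translate s (red w), translate s (blue w))]).
    by apply: bigcupT_measurable => n; have [] := hF n.
  split; [exact: m1|exact: m2|].
  transitivity (P (\bigcup_n [set w | F n (translate s (red w), translate s (blue w))])).
    by [].
  transitivity (P (\bigcup_n [set w | F n (red w, blue w)])); last by [].
  rewrite (measure_semi_bigcup _ _ (tZ (fun w => (red w, blue w))) m1); last first.
    by move=> n; have [] := hF n.
  rewrite (measure_semi_bigcup _ _
    (tZ (fun w => (translate s (red w), translate s (blue w)))) m2); last first.
    by move=> n; have [] := hF n.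
  by apply: eq_eseriesr => n _; have [] := hF n.
Qed.

End invariance.

(** * Observable properties of configurations *)

Section observable.
Context (R : realType).
Notation config := (set (marked_point R) * set (marked_point R))%type.
Implicit Types (c : config) (Q : config -> Prop).

Definition regular c := simple_locally_finite c.1 /\ simple_locally_finite c.2.

(** A property of configurations is observable when, on the regular ones, it
   is an event of the sigma-algebra of configurations. *)
Definition observable Q :=
  exists2 A, config_sigma A & forall c, regular c -> (Q c <-> A c).

Local Notation OT := (g_sigma_algebraType (@void_events R)).

Lemma obs_measurable (A : set config) : measurable (A : set OT) -> observable A.
Proof. by move=> mA; exists A. Qed.

Lemma obs_ext Q Q' : (forall c, regular c -> (Q c <-> Q' c)) ->
  observable Q' -> observable Q.
Proof.
by move=> QQ' [A mA Q'A]; exists A => // c rc; rewrite QQ'//; exact: Q'A.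
Qed.

Lemma obs_not Q : observable Q -> observable (fun c => ~ Q c).
Proof.
move=> [A mA QA]; exists (~` A); first exact: (@measurableC _ OT).
by move=> c rc; rewrite QA.
Qed.

Lemma obs_exists (I : countType) (Q : I -> config -> Prop) :
  (forall i, observable (Q i)) -> observable (fun c => exists i, Q i c).
Proof.
move=> h; have /choice[A hA] i : exists A : set config, config_sigma A /\
    forall c, regular c -> (Q i c <-> A c) by have [A] := h i; exists A.
exists (\bigcup_n (if @pickle_inv I n is Some i then A i else set0)).
  apply: (@bigcupT_measurable _ OT) => n; case: pickle_inv => [i|];
    last exact: measurable0.
  exact: (hA i).1.
move=> c rc; split => [[i Qi]|[n _]].
  by exists (pickle i) => //; rewrite pickleK_inv; exact/(hA i).2.
by case: pickle_inv => // i Ai; exists i; exact/(hA i).2.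
Qed.

Lemma obs_forall (I : countType) (Q : I -> config -> Prop) :
  (forall i, observable (Q i)) -> observable (fun c => forall i, Q i c).
Proof.
move=> h; apply: (@obs_ext _ (fun c => ~ exists i, ~ Q i c)).
  move=> c _; split=> [Qc [i]|nQ i]; first by [].
  by apply: contrapT => nQi; apply: nQ; exists i.
by apply/obs_not/obs_exists => i; exact: obs_not.
Qed.

Lemma obs_and Q Q' : observable Q -> observable Q' ->
  observable (fun c => Q c /\ Q' c).
Proof.
move=> hQ hQ'; apply: (@obs_ext _ (fun c => forall b : bool, if b then Q c else Q' c)).
  by move=> c _; split=> [[? ?] []|h] //; split; [exact: (h true)|exact: (h false)].
by apply: obs_forall => -[].
Qed.

Lemma obs_or Q Q' : observable Q -> observable Q' ->
  observable (fun c => Q c \/ Q' c).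
Proof.
move=> hQ hQ'; apply: (@obs_ext _ (fun c => exists b : bool, if b then Q c else Q' c)).
  by move=> c _; split=> [[?|?]|[[] ?]]; [exists true|exists false|left|right].
by apply: obs_exists => -[].
Qed.

Lemma obs_prop (X : Prop) : observable (fun=> X).
Proof.
have [x|nx] := pselect X.
  exists setT => //; exact: (@measurableT _ OT).
exists set0 => //; exact: (@measurable0 _ OT).
Qed.

(** [true] stands for red and [false] for blue. *)
Definition color_class c (col : bool) := if col then c.1 else c.2.

(** The points with mark [k] in the interval with endpoints [p] and [q], for an
   index [(p, q, k)]. *)
Definition box (i : rat * rat * nat) : set (marked_point R) :=
  [set u | ratr i.1.1 <= u.1 < ratr i.1.2 /\ u.2 = i.2].

(** A point of colour [col] lies in the box [i]. *)
Definition hit c col i := exists2 u, color_class c col u & box i u.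

Lemma measurable_hit col i : measurable ([set c | hit c col i] : set OT).
Proof.
rewrite (_ : [set c | _] = ~` [set c | color_class c col `&` box i = set0]).
  apply: (@measurableC _ OT); apply: sub_sigma_algebra.
  have cb : cell_union (box i) := cell_union_box _ _ [set i.2].
  have c0 := @cell_union0 R.
  exists (if col then box i else set0), (if col then set0 else box i).
  case: col; split => //; apply/seteqP; split => c /=; rewrite setI0; tauto.
apply/seteqP; split => c /=; first by move=> [u cu bu] /seteqP[+ _] => /(_ u);
  exact.
move=> h; apply: contrapT => nh; apply: h; apply/seteqP; split => // u [cu bu].
by apply: nh; exists u.
Qed.

(** [alone c col i u] : [u] is the only point of colour [col] in the box [i]. *)
Definition alone c col i u :=
  [/\ color_class c col u, box i u &
      forall v, color_class c col v -> box i v -> v = u].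

Definition occupied c col i := exists u, alone c col i u.

(** The only point of colour [col] in the box [i], and a default value if there
   is no such point. *)
Definition point c col i : marked_point R := xget (0, 0%N) (alone c col i).

Lemma pointP c col i : occupied c col i -> alone c col i (point c col i).
Proof. exact: xgetPex. Qed.

Lemma alone_point c col i u : alone c col i u -> occupied c col i /\ point c col i = u.
Proof.
move=> h; have oc : occupied c col i by exists u.
by split=> //; have [_ _ uniq_u] := h; have [cp bp _] := pointP oc; exact: uniq_u.
Qed.

Lemma point_color c col i : occupied c col i -> color_class c col (point c col i).
Proof. by case/pointP. Qed.

Lemma point_mark c col i : occupied c col i -> (point c col i).2 = i.2.
Proof. by case/pointP => _ []. Qed.

Lemma ratr_between (x y : R) : x < y -> exists r : rat, x < ratr r < y.
Proof. by move=> /rat_in_itvoo[r]; rewrite in_itv; exists r. Qed.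

(** A point is alone in a box when no rational separates two points of it. *)
Lemma occupiedP c col i : occupied c col i <-> hit c col i /\
  forall r : rat, i.1.1 <= r <= i.1.2 ->
    ~ (hit c col (i.1.1, r, i.2) /\ hit c col (r, i.1.2, i.2)).
Proof.
case: i => [[p q] k] /=; split.
- move=> [u [cu bu hu]]; split; first by exists u.
  move=> r /andP[pr rq] [[v cv [/= /andP[pv vr] vk]] [w cw [/= /andP[rw wq] wk]]].
  have : v = w.
    have pr' : ratr p <= ratr r :> R by rewrite ler_rat.
    have rq' : ratr r <= ratr q :> R by rewrite ler_rat.
    rewrite (hu v cv); last by split=> //=; rewrite pv (lt_le_trans vr rq').
    by rewrite (hu w cw)//; split=> //=; rewrite wq (le_trans pr' rw).
  by move=> vw; move: vr; rewrite vw ltNge rw.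
- move=> [[u cu [/= /andP[pu uq] uk]] h]; exists u; split=> //;
    first by split=> //=; exact/andP.
  move=> v cv [/= /andP[pv vq] vk].
  have H (x y : marked_point R) : color_class c col x -> color_class c col y ->
     x.2 = k -> y.2 = k -> ratr p <= x.1 -> y.1 < ratr q -> x.1 < y.1 -> False.
    move=> cx cy xk yk px yq /ratr_between[r /andP[xr ry]]; apply: (h r).
      apply/andP; split; rewrite -(ler_rat R); first exact: le_trans px (ltW xr).
      exact: le_trans (ltW ry) (ltW yq).
    split; first by exists x => //; split=> //=; rewrite px.
    by exists y => //; split=> //=; rewrite (ltW ry).
  case: (ltgtP v.1 u.1) => [vu|uv|e]; [by case: (H v u)|by case: (H u v)|].
  by rewrite (surjective_pairing v) (surjective_pairing u) e vk uk.
Qed.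


Lemma measurable_occupied col i : measurable ([set c | occupied c col i] : set OT).
Proof.
rewrite (_ : [set c | _] = [set c | hit c col i] `&`
   \bigcap_n (if @pickle_inv rat n is Some r then
     if i.1.1 <= r <= i.1.2 then
     ~` ([set c | hit c col (i.1.1, r, i.2)] `&` [set c | hit c col (r, i.1.2, i.2)])
     else setT else setT)).
  apply: (@measurableI _ OT); first exact: measurable_hit.
  apply: (@bigcapT_measurable _ OT) => n; case: pickle_inv => [r|];
    last exact: measurableT.
  case: ifP => _; last exact: measurableT.
  by apply: (@measurableC _ OT); apply: (@measurableI _ OT); exact: measurable_hit.
apply/seteqP; split => c /=.
  move=> /occupiedP[hc h]; split=> // n _; case: pickle_inv => // r.
  by case: ifP => // pr; exact: h.
move=> [hc h]; apply/occupiedP; split=> // r pr.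
by have := h (pickle r) Logic.I; rewrite pickleK_inv pr.
Qed.

Lemma point_lt c col i (y : R) : occupied c col i -> (point c col i).1 < y <->
  exists r : rat, [/\ r <= i.1.2, ratr r <= y & hit c col (i.1.1, r, i.2)].
Proof.
case: i => [[p q] k] oc; have [cu [/= /andP[pu uq] uk] hu] := pointP oc.
set u := point _ _ _ in cu pu uq uk hu *;
  split=> [uy|[r [/= rq ry [v cv [/= /andP[pv vr] vk]]]]].
- have [r /andP[ur]] : exists r : rat, u.1 < ratr r < Num.min y (ratr q).
    by apply: ratr_between; rewrite lt_min uy.
  rewrite lt_min => /andP[ry rq]; exists r; split; [|exact: ltW|].
    by rewrite -(ler_rat R) ltW.
  by exists u => //; split=> //=; rewrite pu.
- rewrite -(hu v cv); first exact: lt_le_trans vr ry.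
  by split=> //=; rewrite pv (lt_le_trans vr)// ler_rat.
Qed.

Lemma measurable_fun_point col i :
  measurable_fun setT ((fun c => (point c col i).1) : OT -> R).
Proof.
apply: (measurability _ (RGenInftyO.measurableE R)) => //.
move=> _ [_ [y ->] <-]; rewrite setTI.
have mo := measurable_occupied col i.
rewrite (_ : _ @^-1` _ = ([set c | occupied c col i] `&`
     \bigcup_n (if @pickle_inv rat n is Some r then
       if (r <= i.1.2) && (ratr r <= y) then [set c | hit c col (i.1.1, r, i.2)] else set0
       else set0)) `|` (~` [set c | occupied c col i] `&` [set _ | 0 < y])).
  apply: (@measurableU _ OT).
    apply: (@measurableI _ OT) => //; apply: (@bigcupT_measurable _ OT) => n.
    case: pickle_inv => [r|]; last exact: measurable0.
    by case: ifP => _; [exact: measurable_hit|exact: measurable0].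
  apply: (@measurableI _ OT); first exact: (@measurableC _ OT).
  case: (ltP 0 y) => _.
    rewrite (_ : [set _ | _] = setT); [exact: measurableT|by apply/seteqP; split].
  rewrite (_ : [set _ | _] = set0); [exact: measurable0|by apply/seteqP; split].
apply/seteqP; split => c /=; rewrite in_itv /=.
- have [oc|nc] := pselect (occupied c col i).
    move=> /(point_lt _ oc)[r [rq ry hr]]; left; split; first exact: oc.
    by exists (pickle r); [exact: Logic.I|rewrite pickleK_inv rq ry].
  by rewrite /point xgetPN => [? |u au]; [right|apply: nc; exists u].
- move=> [[oc [n _]]|[nc y0]].
    case: pickle_inv => // r; case: ifP => // /andP[rq ry] hr.
    by apply/(point_lt _ oc); exists r.
  by rewrite /point xgetPN// => u au; apply: nc; exists u.
Qed.

Lemma obs_occupied col i : observable (fun c => occupied c col i).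
Proof. exact: obs_measurable (measurable_occupied col i). Qed.

Lemma obs_lt (f g : config -> R) : measurable_fun setT (f : OT -> R) ->
  measurable_fun setT (g : OT -> R) -> observable (fun c => f c < g c).
Proof.
move=> mf mg; apply: obs_measurable.
have mt : measurable [set true] by [].
by have := measurable_fun_ltr mf mg (@measurableT _ OT) mt; rewrite setTI.
Qed.

(** In a regular configuration each point is alone in some box. *)
Lemma regular_alone c col u : regular c -> color_class c col u ->
  exists i, alone c col i u.
Proof.
move=> rc cu; have [sc fc] : simple_locally_finite (color_class c col).
  by case: col {cu}; case: rc.
pose s := [seq v.1 | v <- fset_set
  [set v | color_class c col v /\ `|v.1| <= `|u.1| + 1] & v.1 != u.1].
have [e e0 he] : exists2 e : R, 0 < e & forall y, y \in s -> e <= `|y - u.1|.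
  have : u.1 \notin s by apply/negP => /mapP[v];
    rewrite mem_filter => /andP[/eqP vu _] /esym.
  elim: s => [_|y s IHs]; first by exists 1.
  rewrite inE negb_or => /andP[uy /IHs[e e0 he]].
  exists (Num.min e `|y - u.1|).
    by rewrite lt_min e0 normr_gt0 subr_eq0 eq_sym.
  move=> z; rewrite inE => /predU1P[->|/he ez]; first by rewrite ge_min lexx orbT.
  by rewrite ge_min ez.
have [p /andP[up pu]] : exists p : rat, u.1 - Num.min e 1 < ratr p < u.1.
  by apply: ratr_between; rewrite ltrBlDr ltrDl lt_min e0 ltr01.
have [q /andP[uq qu]] : exists q : rat, u.1 < ratr q < u.1 + Num.min e 1.
  by apply: ratr_between; rewrite ltrDl lt_min e0 ltr01.
exists (p, q, u.2); split => //; first by split=> //=; rewrite ltW.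
move=> v cv [/= /andP[pv vq] _]; apply: sc => //.
apply/eqP/negP => /negP vu.
have vs : v.1 \in s.
  apply/mapP; exists v => //; rewrite mem_filter vu /= in_fset_set// inE;
    split=> //.
  have := ge_min 1 e 1; rewrite lexx orbT => m1.
  have [|] := ger0P v.1; have [|] := ger0P u.1; lra.
have := he _ vs; have := ge_min e e 1; rewrite lexx /= => me.
by have [|] := ger0P (v.1 - u.1); lra.
Qed.

End observable.

(** * The matching graph is observable *)

Section observable_matching.
Context (R : realType).
Notation config := (set (marked_point R) * set (marked_point R))%type.
Notation index := (rat * rat * nat)%type.
Implicit Types (c : config).
Local Notation OT := (g_sigma_algebraType (@void_events R)).

Lemma regular_pointP c col u : regular c -> color_class c col u ->
  exists i, occupied c col i /\ point c col i = u.
Proof. by move=> rc /(regular_alone rc)[i /alone_point]; exists i. Qed.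

(** Quantification over the points of a colour is countable, since each of them
   is [point c col i] for some index [i]. *)
Lemma obs_exists_point col (W : config -> marked_point R -> Prop) :
  (forall c u, W c u -> color_class c col u) ->
  (forall i, observable (fun c => occupied c col i /\ W c (point c col i))) ->
  observable (fun c => exists u, W c u).
Proof.
move=> Wc hW; apply: obs_ext (obs_exists hW) => c rc; split=> [[u Wu]|[i [_ Wi]]].
  by have [i [oi iu]] := regular_pointP rc (Wc _ _ Wu); exists i; rewrite iu.
by exists (point c col i).
Qed.

Lemma obs_point_eq col i j : observable (fun c =>
  [/\ occupied c col i, occupied c col j & point c col i = point c col j]).
Proof.
have lt k l : observable (fun c => (point c col k).1 < (point c col l).1).
  by apply: obs_lt; exact: measurable_fun_point.
apply: (@obs_ext _ _ (fun c => (occupied c col i /\ occupied c col j) /\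
  (i.2 = j.2 /\ (~ (point c col i).1 < (point c col j).1 /\
                 ~ (point c col j).1 < (point c col i).1)))).
  move=> c _; split=> [[oi oj ij]|[[oi oj] [ij [nij nji]]]].
    by rewrite -(point_mark oi) -(point_mark oj) ij ltxx.
  split=> //; rewrite (surjective_pairing (point c col i)).
  rewrite (surjective_pairing (point c col j)) !point_mark// ij; congr (_, _).
  by apply/eqP; rewrite eq_le !leNgt; apply/andP; split; apply/negP.
repeat first [apply: obs_and|apply: obs_not|exact: lt|exact: obs_occupied|exact: obs_prop].
Qed.

(** A set has fewer than [k] elements when no [k] indices give distinct elements
   of it, and the lists of indices are countably many. *)
Lemma obs_counting_lt col (W : config -> marked_point R -> Prop) (k : nat) :
  (forall c u, W c u -> color_class c col u) ->
  (forall i, observable (fun c => occupied c col i /\ W c (point c col i))) ->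
  observable (fun c => (counting (W c) < k%:R%:E :> \bar R)%E).
Proof.
move=> Wc hW; pose i0 : index := (0, 0, 0%N).
apply: (@obs_ext _ _ (fun c => ~ exists l : seq index, size l = k /\
    ((forall n, (n < size l)%N ->
        occupied c col (nth i0 l n) /\ W c (point c col (nth i0 l n))) /\
     (forall m n, (m < size l)%N -> (n < size l)%N -> m <> n ->
       ~ [/\ occupied c col (nth i0 l m), occupied c col (nth i0 l n) &
             point c col (nth i0 l m) = point c col (nth i0 l n)])))).
  move=> c rc; rewrite counting_ltP; split=> h [l]; last first.
    move=> [ul lk lW]; apply: h.
    have /choice[g gP] u : exists i, W c u -> occupied c col i /\ point c col i = u.
      have [Wu|nW] := pselect (W c u); last by exists i0.
      by have [i hi] := regular_pointP rc (Wc _ _ Wu); exists i.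
    have lg n : (n < size l)%N -> occupied c col (g (nth (0, 0%N) l n)) /\
        point c col (g (nth (0, 0%N) l n)) = nth (0, 0%N) l n.
      by move=> nl; apply: gP; apply: lW; exact: mem_nth.
    exists (map g l); rewrite size_map; split=> //; split.
      move=> n nl; rewrite (nth_map (0, 0%N))//; have [og ->] := lg n nl.
      by split=> //; apply: lW; exact: mem_nth.
    move=> m n ml nl mn; rewrite !(nth_map (0, 0%N))// => -[_ _].
    rewrite (lg _ ml).2 (lg _ nl).2 => /eqP; rewrite nth_uniq// => /eqP; exact: mn.
  move=> [lk [lW lu]]; apply: h; exists (map (point c col) l); split.
  - apply/(uniqP (0, 0%N)) => m n; rewrite !inE size_map => ml nl.
    rewrite !(nth_map i0)// => mn; apply: contrapT => /(lu _ _ ml nl); apply.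
    by split=> //; [have [] := lW _ ml|have [] := lW _ nl].
  - by rewrite size_map.
  - by move=> u /mapP[i /(nthP i0)[n nl <-] ->]; have [] := lW _ nl.
apply/obs_not/obs_exists => l; apply: obs_and; first exact: obs_prop.
apply: obs_and; apply: obs_forall => m.
  have [ml|ml] := ltnP m (size l); last exact: obs_ext (obs_prop R True).
  by apply: obs_ext (hW (nth i0 l m)) => c _; split=> [h|h _] //; exact: h.
apply: obs_forall => n.
have [ml|ml] := ltnP m (size l); last exact: obs_ext (obs_prop R True).
have [nl|nl] := ltnP n (size l); last exact: obs_ext (obs_prop R True).
have [->|/eqP mn] := eqVneq m n; first exact: obs_ext (obs_prop R True).
apply: obs_ext (obs_not (obs_point_eq col (nth i0 l m) (nth i0 l n))) => c _.
by split=> [h|h _ _ _] //; exact: h.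
Qed.

(** Observability of a relation between red and blue points, at the points given
   by two indices. Occupation of the boxes is part of the event, as [point] has a
   meaningless value in the other case. *)
Definition observable_rel (Q : config -> marked_point R -> marked_point R -> Prop) :=
  forall i j, observable (fun c => (occupied c true i /\ occupied c false j) /\
    Q c (point c true i) (point c false j)).

Lemma obs_dist_le i j i' j' : observable (fun c =>
  dist (point c true i) (point c false j) <= dist (point c true i') (point c false j')).
Proof.
apply: (@obs_ext _ _ (fun c => ~ dist (point c true i') (point c false j') <
   dist (point c true i) (point c false j))).
  by move=> c _; rewrite leNgt; split=> /negP.
apply/obs_not/obs_lt.
all: apply: measurableT_comp; first exact: normr_measurable.
all: by apply: measurable_funB; exact: measurable_fun_point.
Qed.

(** The mark of the point alone in the box [i] is [i.2], so the numbers of stubs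
   to compare with do not depend on the configuration. *)
Lemma observable_compatible (E : config -> marked_point R -> marked_point R -> Prop) :
  (forall c u v, E c u v -> c.1 u /\ c.2 v) -> observable_rel E ->
  observable_rel (fun c => compatible c.1 c.2 (E c)).
Proof.
move=> Ec hE i j.
apply: (@obs_ext _ _ (fun c => (occupied c true i /\ occupied c false j) /\
  (((counting [set v | (occupied c true i) /\ E c (point c true i) v]
       < i.2%:R%:E :> \bar R)%E /\
    (counting [set u | (occupied c false j) /\ E c u (point c false j)]
       < j.2%:R%:E :> \bar R)%E)
   /\ ~ ((occupied c true i /\ occupied c false j) /\
         E c (point c true i) (point c false j))))).
  move=> c _.
  have eqr : occupied c true i ->
      [set v | (occupied c true i) /\ E c (point c true i) v] =
      [set v | E c (point c true i) v].
    by move=> oi; apply/seteqP; split=> v /=; [case|].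
  have eqb : occupied c false j ->
      [set u | (occupied c false j) /\ E c u (point c false j)] =
      [set u | E c u (point c false j)].
    by move=> oi; apply/seteqP; split=> v /=; [case|].
  split=> -[[oi oj]].
    move=> [ru bv su sv nE]; split=> //; rewrite eqr// eqb//; split; last by case.
    by move: su sv; rewrite /red_stub_left /blue_stub_left !point_mark.
  rewrite eqr// eqb// => -[[su sv] nE]; split=> //; split.
  - exact: point_color oi.
  - exact: point_color oj.
  - by rewrite /red_stub_left point_mark.
  - by rewrite /blue_stub_left point_mark.
  - by move=> Eij; apply: nE.
have oc := @obs_occupied R.
apply: obs_and; first exact: obs_and.
apply: obs_and; last exact/obs_not/hE.
apply: obs_and.
- apply: (@obs_counting_lt false (fun c v => occupied c true i /\ E c (point c true i) v)).
    by move=> c u [_ /Ec[]].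
  by move=> k; apply: obs_ext (hE i k) => c _; tauto.
- apply: (@obs_counting_lt true (fun c u => occupied c false j /\ E c u (point c false j))).
    by move=> c u [_ /Ec[]].
  by move=> k; apply: obs_ext (hE k j) => c _; tauto.
Qed.

Lemma observable_mutually_closest (E : config -> marked_point R -> marked_point R -> Prop) :
  (forall c u v, E c u v -> c.1 u /\ c.2 v) -> observable_rel E ->
  observable_rel (fun c => mutually_closest c.1 c.2 (E c)).
Proof.
move=> Ec /(observable_compatible Ec) hC i j.
pose K c := compatible c.1 c.2 (E c).
pose r c v' := (occupied c true i /\ occupied c false j) /\
  [/\ K c (point c true i) v', v' <> point c false j &
     dist (point c true i) v' <= dist (point c true i) (point c false j)].
pose b c u' := (occupied c true i /\ occupied c false j) /\
  [/\ K c u' (point c false j), u' <> point c true i &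
     dist u' (point c false j) <= dist (point c true i) (point c false j)].
apply: (@obs_ext _ _ (fun c => ((occupied c true i /\ occupied c false j) /\
  K c (point c true i) (point c false j)) /\
  (~ (exists v', r c v') /\ ~ exists u', b c u'))).
  move=> c _; split.
  - move=> [oo [Kc h1 h2]]; split=> //; split.
    + by move=> [v' [_ [Kv' vv']]]; rewrite leNgt => /negP; apply; exact: h1.
    + by move=> [u' [_ [Ku' uu']]]; rewrite leNgt => /negP; apply; exact: h2.
  - move=> [[oo Kc] [nr nb]]; split=> //; split=> //.
    + by move=> v' Kv' vv'; rewrite ltNge; apply/negP => h; apply: nr; exists v'.
    + by move=> u' Ku' uu'; rewrite ltNge; apply/negP => h; apply: nb; exists u'.
have oc := @obs_occupied R.
apply: obs_and; first exact: hC.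
apply: obs_and; apply: obs_not.
- apply: (@obs_exists_point false); first by move=> c v [_ [[]]].
  move=> k; apply: (@obs_ext _ _ (fun c => (occupied c true i /\ occupied c false j) /\
    (((occupied c true i /\ occupied c false k) /\
      K c (point c true i) (point c false k)) /\
    (~ [/\ occupied c false k, occupied c false j & point c false k = point c false j] /\
     dist (point c true i) (point c false k) <= dist (point c true i) (point c false j))))).
    move=> c _; split=> [[ok [oo [Kk ne le]]]|[[oi oj] [[[_ ok] Kk] [ne le]]]].
      by case: (oo) => oi oj; do !split => //; case.
    by do !split => //; move=> e; apply: ne.
  apply: obs_and; first exact: obs_and.
  apply: obs_and; first exact: hC.
  apply: obs_and; [exact/obs_not/obs_point_eq|exact: obs_dist_le].
- apply: (@obs_exists_point true); first by move=> c v [_ [[]]].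
  move=> k; apply: (@obs_ext _ _ (fun c => (occupied c true i /\ occupied c false j) /\
    (((occupied c true k /\ occupied c false j) /\
      K c (point c true k) (point c false j)) /\
    (~ [/\ occupied c true k, occupied c true i & point c true k = point c true i] /\
     dist (point c true k) (point c false j) <= dist (point c true i) (point c false j))))).
    move=> c _; split=> [[ok [oo [Kk ne le]]]|[[oi oj] [[[ok _] Kk] [ne le]]]].
      by case: (oo) => oi oj; do !split => //; case.
    by do !split => //; move=> e; apply: ne.
  apply: obs_and; first exact: obs_and.
  apply: obs_and; first exact: hC.
  apply: obs_and; [exact/obs_not/obs_point_eq|exact: obs_dist_le].
Qed.

Lemma observable_matching_stage n :
  observable_rel (fun c => matching_stage c.1 c.2 n).
Proof.
elim: n => [|n IHn] i j.
  by apply: obs_ext (obs_prop R False) => c _; split=> // -[_].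
have col c u v : matching_stage c.1 c.2 n u v -> c.1 u /\ c.2 v.
  by move=> h; apply: (@stable_multi_matching_color _ c.1 c.2 u v); exists n.
apply: obs_ext (obs_or (IHn i j) (observable_mutually_closest col IHn i j)) => c _.
rewrite /matching_stage iterS -/(matching_stage _ _ _) /matching_step; tauto.
Qed.

Lemma observable_stable_multi_matching :
  observable_rel (fun c => stable_multi_matching c.1 c.2).
Proof.
move=> i j; apply: obs_ext (obs_exists (fun n => observable_matching_stage n i j)).
move=> c _; split=> [[oo [n h]]|[n [oo h]]]; first by exists n.
by split=> //; exists n.
Qed.

(** Vertices of the matching graph are indexed by a colour and a box. *)
Definition vertex_point c (a : bool * index) : vertex R :=
  if a.1 then inl (point c true a.2) else inr (point c false a.2).

Definition vertex_occupied c (a : bool * index) := occupied c a.1 a.2.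

Lemma regular_vertexP c x : regular c -> vertices c.1 c.2 x ->
  exists a, vertex_occupied c a /\ vertex_point c a = x.
Proof.
case: x => u rc.
  move=> /inl_vertices cu; have [i [oi <-]] := @regular_pointP c true u rc cu.
  by exists (true, i).
move=> /inr_vertices cu; have [i [oi <-]] := @regular_pointP c false u rc cu.
by exists (false, i).
Qed.

Lemma vertex_occupiedP c a : vertex_occupied c a -> vertices c.1 c.2 (vertex_point c a).
Proof.
case: a => [[] i] /= o; first exact/inl_vertices/(@point_color _ c true).
exact/inr_vertices/(@point_color _ c false).
Qed.

Lemma obs_vertex_occupied a : observable (fun c => vertex_occupied c a).
Proof. exact: obs_occupied. Qed.

Lemma obs_exists_vertex (W : config -> vertex R -> Prop) :
  (forall c x, W c x -> vertices c.1 c.2 x) ->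
  (forall a, observable (fun c => vertex_occupied c a /\ W c (vertex_point c a))) ->
  observable (fun c => exists x, W c x).
Proof.
move=> Wc hW; apply: obs_ext (obs_exists hW) => c rc; split=> [[x Wx]|[a [_ Wa]]].
  by have [a [oa ax]] := regular_vertexP rc (Wc _ _ Wx); exists a; rewrite ax.
by exists (vertex_point c a).
Qed.

Lemma measurable_fun_vertex_pos a :
  measurable_fun setT ((fun c => vertex_pos (vertex_point c a)) : OT -> R).
Proof. by case: a => [[] i]; exact: measurable_fun_point. Qed.

Definition observable_vertex_rel (Q : config -> vertex R -> vertex R -> Prop) :=
  forall a b, observable (fun c => (vertex_occupied c a /\ vertex_occupied c b) /\
    Q c (vertex_point c a) (vertex_point c b)).

Lemma observable_adjacent :
  observable_vertex_rel (fun c => matching_adjacent c.1 c.2).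
Proof.
move=> [[] i] [[] j].
- by apply: obs_ext (obs_prop R False) => c _; split=> // -[].
- exact: observable_stable_multi_matching.
- apply: obs_ext (observable_stable_multi_matching j i) => c _.
  rewrite /vertex_occupied /=; tauto.
- by apply: obs_ext (obs_prop R False) => c _; split=> // -[].
Qed.

(** Walks of length [n] in the matching graph. *)
Fixpoint walk c (n : nat) (x y : vertex R) : Prop :=
  if n is n'.+1 then exists z, walk c n' x z /\ matching_adjacent c.1 c.2 z y
  else x = y.

Lemma connP c x y : clos_refl_trans _ (matching_adjacent c.1 c.2) x y <->
  exists n, walk c n x y.
Proof.
split.
  move=> xy; have := clos_rt_rtn1 _ _ _ _ xy.
  elim=> [|z w zw _ [n xz]]; first by exists 0%N.
  by exists n.+1, z.
move=> [n]; elim: n y => [y ->|n IHn y [z [xz zy]]]; first exact: rt_refl.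
exact: rt_trans (IHn _ xz) (rt_step _ _ _ _ zy).
Qed.

Lemma observable_walk n : observable_vertex_rel (fun c => walk c n).
Proof.
elim: n => [|n IHn] a b.
  case: a b => [[] i] [[] j].
  - apply: obs_ext (obs_point_eq true i j) => c _ /=.
    by split=> [[[oi oj] [e]]|[oi oj e]]; split=> //; rewrite /vertex_point /= e.
  - by apply: obs_ext (obs_prop R False) => c _; split=> // -[].
  - by apply: obs_ext (obs_prop R False) => c _; split=> // -[].
  - apply: obs_ext (obs_point_eq false i j) => c _ /=.
    by split=> [[[oi oj] [e]]|[oi oj e]]; split=> //; rewrite /vertex_point /= e.
have : observable (fun c => exists z, (vertex_occupied c a /\ vertex_occupied c b) /\
    (walk c n (vertex_point c a) z /\ matching_adjacent c.1 c.2 z (vertex_point c b))).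
  apply: obs_exists_vertex => [c z [_ [_ /matching_adjacentP[]//]]|e].
  apply: obs_ext (obs_and (IHn a e) (observable_adjacent e b)) => c _; tauto.
apply: obs_ext => c _; split=> [[oo [z hz]]|[z [oo hz]]]; first by exists z.
by split=> //; exists z.
Qed.

Lemma observable_conn :
  observable_vertex_rel (fun c => clos_refl_trans _ (matching_adjacent c.1 c.2)).
Proof.
move=> a b; apply: obs_ext (obs_exists (fun n => observable_walk n a b)) => c _.
split=> [[oo /connP[n h]]|[n [oo h]]]; first by exists n.
by split=> //; apply/connP; exists n.
Qed.

Lemma matching_conn_vertices (r b : set (marked_point R)) (x y : vertex R) :
  vertices r b x ->
  clos_refl_trans _ (matching_adjacent r b) x y -> vertices r b y.
Proof. by move=> vx xy; apply: conn_vs vx xy; exact: matching_adjacentP. Qed.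

Lemma observable_right_end_in (t : R) : observable (right_end_in t).
Proof.
apply: (@obs_ext _ _ (fun c => exists x,
    (vertices c.1 c.2 x) /\
    (~ (exists y, (vertices c.1 c.2 x /\
          clos_refl_trans _ (matching_adjacent c.1 c.2) x y) /\
          vertex_pos x < vertex_pos y) /\
    ((forall N : nat, exists y, (vertices c.1 c.2 x /\
          clos_refl_trans _ (matching_adjacent c.1 c.2) x y) /\ vertex_pos y < - N%:R) /\
     (~ vertex_pos x < t /\ vertex_pos x < t + 1))))).
  move=> c _; split=> -[x].
  - move=> [vx mx ux] /andP[tx xt]; exists x; split=> //; split; last split.
    + by move=> [y [[_ /mx]]]; rewrite leNgt => /negP.
    + by move=> N; have [y xy yN] := ux (- N%:R); exists y.
    + by split=> //; apply/negP; rewrite -leNgt.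
  - move=> [vx [nx [ux [tx xt]]]]; exists x; last by rewrite leNgt xt andbT;
      exact/negP.
    split=> //.
    + by move=> y xy; rewrite leNgt; apply/negP => h; apply: nx; exists y.
    + move=> N; have [y [[_ xy] yN]] := ux (Num.bound `|N|); exists y => //.
      have := archi_boundP (normr_ge0 N); have := ler_norm (- N).
      by rewrite normrN; lra.
have ov := obs_vertex_occupied.
apply: obs_exists_vertex; first by move=> c x [].
have conn a b : observable (fun c => vertex_occupied c b /\ (vertex_occupied c a /\
    clos_refl_trans _ (matching_adjacent c.1 c.2) (vertex_point c a) (vertex_point c b))).
  by apply: obs_ext (observable_conn a b) => c _; tauto.
move=> a; apply: (@obs_ext _ _ (fun c => vertex_occupied c a /\
    (~ (exists y, ((vertex_occupied c a) /\
          clos_refl_trans _ (matching_adjacent c.1 c.2) (vertex_point c a) y) /\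
          vertex_pos (vertex_point c a) < vertex_pos y) /\
    ((forall N : nat, exists y, (vertex_occupied c a /\
          clos_refl_trans _ (matching_adjacent c.1 c.2) (vertex_point c a) y) /\
          vertex_pos y < - N%:R) /\
     (~ vertex_pos (vertex_point c a) < t /\ vertex_pos (vertex_point c a) < t + 1))))).
  move=> c _; split=> [[oa [_ [h1 [h2 h3]]]]|[oa [h1 [h2 h3]]]];
    (have va := vertex_occupiedP oa).
    split=> //; split; last split=> //.
      by move=> [y [[_ xy] h]]; apply: h1; exists y.
    by move=> N; have [y [[_ xy] h]] := h2 N; exists y.
  do 2!split=> //; split; last split=> //.
    by move=> [y [[_ xy] h]]; apply: h1; exists y.
  by move=> N; have [y [[_ xy] h]] := h2 N; exists y.
have mp := measurable_fun_vertex_pos.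
apply: obs_and => //; apply: obs_and; last apply: obs_and.
- apply/obs_not/obs_exists_vertex.
    by move=> c y [[/vertex_occupiedP va ay] _]; exact: matching_conn_vertices ay.
  move=> b; apply: obs_ext (obs_and (conn a b) (obs_lt (mp a) (mp b))) => c _;
    tauto.
- apply: obs_forall => N; apply: obs_exists_vertex.
    by move=> c y [[/vertex_occupiedP va ay] _]; exact: matching_conn_vertices ay.
  move=> b; have mN : measurable_fun setT ((fun=> - N%:R) : OT -> R).
    exact: measurable_cst.
  by apply: obs_ext (obs_and (conn a b) (obs_lt (mp b) mN)) => c _; tauto.
- have mt : measurable_fun setT ((fun=> t) : OT -> R) by exact: measurable_cst.
  have mt1 : measurable_fun setT ((fun=> t + 1) : OT -> R) by exact: measurable_cst.
  by apply: obs_and; [apply/obs_not|]; exact: obs_lt.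
Qed.

End observable_matching.

(** * Absence of right ends *)

Lemma simple_locally_finite_translate (R : realType) (s : R) (r : set (marked_point R)) :
  simple_locally_finite r -> simple_locally_finite (translate s r).
Proof.
move=> [hr fr]; split.
  move=> [x k] [y l] /= ru rv /= xy; rewrite xy in ru *.
  by have [->] := hr _ _ ru rv erefl.
move=> N; apply: sub_finite_set (finite_image (fun u => (u.1 + s, u.2)) (fr (N + `|s|))).
move=> u /= [ru uN]; exists (u.1 - s, u.2);
  last by rewrite /= subrK -surjective_pairing.
by split=> //=; apply: le_trans (ler_normB _ _) _; rewrite lerD2r.
Qed.

Lemma marked_poisson_regular (d : measure_display) (T : measurableType d)
  (R : realType) (P : probability T R) (lambda : R) (nu : probability nat R)
  (xi : T -> set (marked_point R)) : 0 < lambda -> marked_poisson P lambda nu xi ->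
  {ae P, forall w, simple_locally_finite (xi w)}.
Proof.
move=> l0 [_ hP [X [D [XD _ _]]]].
pose I (n : nat) : set R := `[- n%:R, n%:R]%classic.
have fin : {ae P, forall w, forall n : nat, finite_set ((fst @` xi w) `&` I n)}.
  apply/ae_foralln => n; have mI : measurable (I n) by exact: measurable_itv.
  have fI : (lebesgue_measure (I n) < +oo)%E.
    by rewrite lebesgue_measure_itv /=; case: ifP => // _; rewrite -EFinB ltry.
  apply: filterS (count_finite l0 hP mI fI) => w [k].
  by rewrite /count /counting; case: asboolP.
apply: filterS2 XD fin => w [Xinj xiE] hfin.
have inj u v : xi w u -> xi w v -> u.1 = v.1 -> u = v.
  by rewrite xiE => -[n _ <-] [m _ <-] /= /Xinj ->.
split=> // N; pose n := Num.bound `|N|.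
apply: (@sub_finite_set _ _ (xi w `&` fst @^-1` ((fst @` xi w) `&` I n))).
  move=> u /= [xu uN]; split=> //; split; first by exists u.
  rewrite /I /= in_itv /= -ler_norml; apply: le_trans uN _.
  by apply: le_trans (ler_norm _) _; apply/ltW/archi_boundP.
pose f (x : R) : marked_point R := xget (0, 0%N) [set u | xi w u /\ u.1 = x].
apply: sub_finite_set (finite_image f (hfin n)) => u /= [xu hu]; exists u.1 => //.
have [xf fu] : [set v | xi w v /\ v.1 = u.1] (f u.1) by apply: xgetPex; exists u.
exact: inj.
Qed.

(** Infinitely many disjoint events of equal probability are null. *)
Lemma disjoint_equiprobable_null (d : measure_display) (T : measurableType d)
  (R : realType) (P : probability T R) (F : nat -> set T) :
  (forall n, measurable (F n)) -> trivIset setT F ->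
  (forall n, P (F n) = P (F 0%N)) -> P (F 0%N) = 0%E.
Proof.
move=> mF tF PF; pose p := fine (P (F 0%N)).
have pE : P (F 0%N) = p%:E by rewrite fineK// fin_num_measure.
have p0 : 0 <= p by rewrite fine_ge0.
suff ple0 : p <= 0 by rewrite pE; congr _%:E; apply/eqP; rewrite eq_le ple0 p0.
rewrite leNgt; apply/negP => pgt0.
have H (n : nat) : n%:R * p <= 1.
  have mU : measurable (\bigcup_(i < n) F i) by exact: bigcup_measurable.
  have := probability_le1 P mU; rewrite bigcup_mkord measure_bigsetU//.
  rewrite (eq_bigr (fun=> p%:E)); last first.
    by move=> i _; apply: etrans (PF i) pE.
  by rewrite sumEFin lee_fin sumr_const card_ord mulr_natl.
have := H (Num.bound p^-1); have : p^-1 < (Num.bound p^-1)%:R.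
  by apply: archi_boundP; rewrite invr_ge0 ltW.
by rewrite -(ltr_pM2r pgt0) mulVf ?gt_eqF// => h1 h2;
  have := lt_le_trans h1 h2; rewrite ltxx.
Qed.

Section right_end_null.
Context (d : measure_display) (T : measurableType d) (R : realType).
Variables (P : probability T R) (lr lb : R) (lr0 : 0 < lr) (lb0 : 0 < lb).
Variables (nu mu : probability nat R) (red blue : T -> set (marked_point R)).
Hypotheses (red_law : marked_poisson P lr nu red)
  (blue_law : marked_poisson P lb mu blue)
  (red_blue_indep : independent P (sigma_process R red) (sigma_process R blue)).

Lemma ae_regular : {ae P, forall w, regular (red w, blue w)}.
Proof.
apply: filterS2 (marked_poisson_regular lr0 red_law) (marked_poisson_regular lb0 blue_law).
by move=> w.
Qed.

(** The right ends in [t + n, t + n + 1), for n = 0, 1, 2, ..., are disjoint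
   events of the same probability. *)
Lemma ae_no_right_end_in (t : R) : {ae P, forall w, ~ right_end_in t (red w, blue w)}.
Proof.
have /choice[A hA] (n : nat) : exists A, config_sigma A /\
    forall c, regular c -> (right_end_in (t + n%:R) c <-> A c).
  by have [A] := observable_right_end_in (t + n%:R); exists A.
pose F n := [set w | A n (red w, blue w)].
have mF n : measurable (F n).
  by have [] := config_law_translate lr0 lb0 red_law blue_law red_blue_indep 0 (hA n).1.
have PF n : P (F n) = P (F 0%N).
  have [_ m2 <-] := config_law_translate lr0 lb0 red_law blue_law
    red_blue_indep n%:R (hA n).1.
  apply: ae_eq_prob => //; apply: filterS ae_regular => w rw.
  have rw' : regular (translate n%:R (red w), translate n%:R (blue w)).
    by split; apply: simple_locally_finite_translate; case: rw.
  rewrite /F /= -(hA 0%N).2// -(hA n).2// addr0.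
  exact: right_end_in_translate.
have [N [mN N0 hN]] := ae_regular.
have regN w : ~ N w -> regular (red w, blue w).
  by move=> nN; apply: contrapT => nr; apply: nN; exact: hN.
have aeN : {ae P, forall w, ~ N w}.
  by exists N; split => // w /= /contrapT.
pose F' n := F n `\` N.
have mF' n : measurable (F' n) by exact: measurableD.
have PF' n : P (F' n) = P (F n).
  apply: ae_eq_prob => //; apply: filterS aeN => w nNw; split=> [[]//|Fw].
  by split.
have tF' : trivIset setT F'.
  move=> i j _ _ [w [[Fi nN] [Fj _]]]; have rw := regN w nN.
  wlog ij : i j Fi Fj / (i < j)%N.
    by move=> H; case: (ltngtP i j) => // ij; [exact: H|apply/esym; exact: H].
  have [rr rb] := rw; case: (@right_end_in_disjoint R _ _ (t + i%:R) (t + j%:R) rr rb).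
  - exact/(hA i).2.
  - exact/(hA j).2.
  - by rewrite -addrA lerD2l natr1 ler_nat.
have P0 : P (F 0%N) = 0%E.
  rewrite -PF'; apply: disjoint_equiprobable_null => // n.
  by rewrite !PF' PF.
apply: (@filterS2 _ _ _ _ _ _ _ ae_regular (_ : {ae P, forall w, ~ F 0%N w})).
  move=> w rw nF rt; apply: nF; apply/(hA 0%N).2 => //.
  by rewrite addr0.
by exists (F 0%N); split => // w /= /contrapT.
Qed.

Lemma ae_no_right_end :
  {ae P, forall w, forall x, ~ matching_right_end (red w) (blue w) x}.
Proof.
have : {ae P, forall w, forall n : nat, forall b : bool,
    ~ right_end_in (if b then n%:R else - n%:R) (red w, blue w)}.
  apply/ae_foralln => n.
  apply: filterS2 (ae_no_right_end_in n%:R) (ae_no_right_end_in (- n%:R)).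
  by move=> w h1 h2 [].
apply: filterS => w h x rx.
pose z := Num.floor (vertex_pos x).
have : right_end_in z%:~R (red w, blue w).
  exists x => //; rewrite floor_le /=.
  by have := lt_succ_floor (vertex_pos x); rewrite intrD.
by case: z => n; [exact: (h n true)|rewrite NegzE mulrNz; exact: (h n.+1 false)].
Qed.

End right_end_null.

Theorem proposition1
  (d : measure_display) (T : measurableType d) (R : realType)
  (P : probability T R)
  (lambda_red lambda_blue : R)
  (lambda_red_gt0 : 0 < lambda_red) (lambda_blue_gt0 : 0 < lambda_blue)
  (nu mu : probability nat R)
  (nu_pos : nu [set 0%N] = 0%E) (mu_pos : mu [set 0%N] = 0%E)
  (nu_mean : (\int[nu]_k k%:R%:E < +oo :> \bar R)%E)
  (mu_mean : (\int[mu]_k k%:R%:E < +oo :> \bar R)%E)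
  (balance : (lambda_red%:E * \int[nu]_k k%:R%:E =
              lambda_blue%:E * \int[mu]_k k%:R%:E)%E)
  (red blue : T -> set (marked_point R))
  (red_law : marked_poisson P lambda_red nu red)
  (blue_law : marked_poisson P lambda_blue mu blue)
  (red_blue_indep : independent P (sigma_process R red) (sigma_process R blue)) :
  {ae P, forall w, is_subset1
     (infinite_components (red w) (blue w)
        (stable_multi_matching (red w) (blue w)))}.
Proof.
have reg := ae_regular lambda_red_gt0 lambda_blue_gt0 red_law blue_law.
have nre := ae_no_right_end lambda_red_gt0 lambda_blue_gt0 red_law blue_law
  red_blue_indep.
apply: filterS2 reg nre => w [gr gb]; exact: infinite_components_subset1.
Qed.
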